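(* Let $G=(V,E)$ be a transitive graph of polynomial growth with dimension $d\ge 1$ and suppose that $J:V\times V\to[0,\infty)$ is a transitive kernel satisfying $J(x,y)=\Omega(d_G(x,y)^{-d\alpha})$ with $\alpha\in(1,2)$. Then the set $\{\beta\in[0,\infty):\theta(\beta)>0\}$ is open. In particular, $\theta(\beta_c)=0$.
   Context: Graphs are infinite, connected, locally finite and simple. $G=(V,E)$ is transitive if its automorphism group acts transitively on $V$; $o$ is a fixed origin, $d_G$ the graph metric, $B(r)=\{x: d_G(o,x)\le r\}$, and $\#A$ is the cardinality of $A$. A transitive graph of polynomial growth has a unique positive integer $d=\dim(G)$, its dimension, for which there are $c_G,C_G>0$ with $c_Gr^d\le \#B(r)\le C_Gr^d$ for all $r\in\mathbb N=\{1,2,\dots\}$. A kernel $J:V\times V\to[0,\infty)$ is symmetric, and it is transitive if $J(\gamma x,\gamma y)=J(x,y)$ for every graph automorphism $\gamma$. $J(x,y)=\Omega(d_G(x,y)^{-d\alpha})$ means there are $c_J,R_J>0$ with $J(x,y)\ge c_Jd_G(x,y)^{-d\alpha}$ whenever $d_G(x,y)\ge R_J$. Long-range percolation on $G$ with kernel $J$ and parameter $\beta\ge0$ is the random graph with vertex set $V$ in which each unordered pair of distinct vertices $\{x,y\}$ is an edge independently with probability $1-\exp(-\beta J(x,y))$. Its law is $\mathbf P_\beta$; $K$ is the connected component (cluster) of $o$; $\theta(\beta)=\mathbf P_\beta(\#K=\infty)$ and $\beta_c=\inf\{\beta\ge0:\theta(\beta)>0\}$. *)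

(* Defs.v *)
From HB Require Import structures.
From mathcomp Require Import all_boot all_order all_algebra finmap.
From mathcomp Require Import all_classical all_reals all_analysis.
Import Order.TTheory GRing.Theory Num.Theory.
Import numFieldNormedType.Exports.

Set Implicit Arguments.
Unset Strict Implicit.
Unset Printing Implicit Defensive.

Local Open Scope classical_set_scope.
Local Open Scope fset_scope.
Local Open Scope ring_scope.

Section Graphs.
Variables (V : choiceType) (E : rel V).

Definition connected_by (x y : V) (n : nat) : Prop :=
  exists p : seq V, [/\ path E x p, last x p = y & size p = n].

Record infinite_graph : Prop := InfiniteGraph {
  graph_sym : symmetric E;
  graph_irr : irreflexive E;
  graph_infinite : infinite_set [set: V];
  graph_connected : forall x y, exists n, connected_by x y n;
  graph_locally_finite : forall x, finite_set [set y | E x y]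
}.

Definition graph_automorphism (g : V -> V) : Prop :=
  bijective g /\ forall x y, E (g x) (g y) = E x y.

Definition transitive_graph : Prop :=
  forall x y, exists2 g, graph_automorphism g & g x = y.

(* The default value 0 is returned only when no path joins x to y. *)
Definition graph_dist (x y : V) : nat :=
  xget 0%N [set n | connected_by x y n
                  /\ forall m, connected_by x y m -> (n <= m)%N].

Definition graph_ball (o : V) (r : nat) : set V :=
  [set x | (graph_dist o x <= r)%N].

(* fset_set sends an infinite set to fset0, but balls are finite in a locally
   finite graph. *)
Definition growth_dimension (R : realType) (o : V) (d : nat) : Prop :=
  exists c C : R, [/\ 0 < c, 0 < C & forall r : nat, (0 < r)%N ->
    c * r%:R ^+ d <= #|` fset_set (graph_ball o r)|%:R <= C * r%:R ^+ d].

Record transitive_kernel (R : realType) (J : V -> V -> R) : Prop :=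
  TransitiveKernel {
    kernel_ge0 : forall x y, 0 <= J x y;
    kernel_sym : forall x y, J x y = J y x;
    kernel_trans : forall g, graph_automorphism g ->
      forall x y, J (g x) (g y) = J x y
  }.

Definition kernel_Omega (R : realType) (J : V -> V -> R) (s : R) : Prop :=
  exists cJ RJ : R, [/\ 0 < cJ, 0 < RJ & forall x y,
    RJ <= (graph_dist x y)%:R -> cJ * (graph_dist x y)%:R `^ s <= J x y].

End Graphs.

Section Percolation.
Variable V : choiceType.

Definition edge : Type := {e : {fset V} | #|` e| == 2}.

Definition config : Type := edge -> bool.

Definition edge_open (e : edge) : set config := [set w | w e].

Definition config_space :=
  g_sigma_algebraType (range edge_open).

(* insub [fset x; y] is None exactly when x = y. *)
Definition joined (w : config) : rel V :=
  fun x y => if insub [fset x; y] is Some e then w e else false.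

Definition cluster (w : config) (x : V) : set V :=
  [set y | exists2 p, path (joined w) x p & last x p = y].

Variables (R : realType) (J : V -> V -> R).

(* Characterizes the product measure on config_space: the edge_open events
   generate the sigma-algebra and their finite intersections form a pi-system. *)
Record percolation_law (beta : R) (P : probability config_space R) : Prop :=
  PercolationLaw {
    edge_prob : forall x y, x != y ->
      P [set w | joined w x y] = (1 - expR (- (beta * J x y)))%:E;
    edge_indep : forall F : {fset edge},
      P [set w | forall e, e \in F -> edge_open e w]
      = (\prod_(e <- F) P (edge_open e))%E
  }.

Variables (P : R -> probability config_space R) (o : V).

Definition theta (beta : R) : R :=
  fine (P beta [set w | infinite_set (cluster w o)]).

Definition percolating : set R := [set beta | 0 <= beta /\ 0 < theta beta].

Definition beta_c : R := inf percolating.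

End Percolation.

(* Main.v *)
Require Import Defs.
From HB Require Import structures.
From mathcomp Require Import all_boot all_order all_algebra finmap.
From mathcomp Require Import all_classical all_reals all_analysis.
From mathcomp Require Import ring lra zify.
Import Order.TTheory GRing.Theory Num.Theory.
Import numFieldNormedType.Exports.

(** Write b(n) for the probability that the cluster of o has at least n
    vertices, so that theta = lim b(n).  The proof compares b(n) with b(n'),
    where n' is a power of n with exponent larger than 1:
        b(n) <= b(n') + error,
    the error being a negative power of n, uniformly over beta bounded away
    from 0 (merge_step).  Iterated along a sequence of scales this gives
    theta(beta) >= b(n) - eps(n), where eps(n) tends to 0 locally uniformly in
    beta > 0 (finite_criterion).  Hence theta(beta) > 0 as soon as an event
    inside some finite ball has probability above eps(n); conversely
    theta(beta) > 0 forces such an event to exist, and its probability is a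
    continuous function of beta (large_prob_continuous).  So the set of
    percolating parameters is open.  It does not contain 0, so it cannot
    contain its infimum.

    The comparison is made inside a ball of radius k, percolation being
    restricted to that ball; k tends to infinity at the end, and polynomial
    growth makes the boundary of the ball negligible along the way (folner).
    Fix a scale r.  Its core is a two-ghost inequality in the spirit of
    Aizenman, Kesten and Newman (two_ghost): a pair of vertices at distance of
    order r is rarely split between two distinct clusters having at least n
    vertices each.  For the number of closed pairs touching a given cluster,
    centred by its expectation given the number of pairs examined, is of the
    order of a square root, while every split pair is counted twice in the sum
    of these quantities over all clusters, each cluster C being weighted by
    min(|C|, n).

    Now suppose that a vertex x lies in a cluster with at least n but fewer
    than n' vertices, and that many more than n' of the vertices within
    distance 2r of x lie in clusters with at least n vertices.  Then x belongs
    to many split pairs, which is rare.  Vertices having few such neighbours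
    are also rare, by double counting over balls of radius r (low_density).
    So most vertices of clusters of size at least n are in clusters of size at
    least n' (merge_expect).  The kernel makes pairs at distance of order r
    open with probability at least of order r^(-d alpha), and with this the
    error is small as soon as r^(d (alpha - 1)) is small compared with n,
    whereas n' may be nearly as large as r^d.  Since alpha < 2, n' can be
    taken much larger than n, and the scales r = 2^i chain together
    (scales). *)

Set Implicit Arguments.
Unset Strict Implicit.
Unset Printing Implicit Defensive.
Local Open Scope classical_set_scope.
Local Open Scope ring_scope.

(** * Bernoulli percolation on a finite graph *)

Section FinitePercolation.
Variables (R : realType) (I T : finType) (s t : I -> T).
Implicit Types (p : I -> R) (f g : {ffun I -> bool} -> R) (sg tau : {ffun I -> bool}).

Definition bern (q : R) (b : bool) : R := if b then q else 1 - q.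

Definition weight p sg : R := \prod_e bern (p e) (sg e).

Definition expect p f : R := \sum_(sg : {ffun I -> bool}) weight p sg * f sg.

Definition set_edge (sg : {ffun I -> bool}) (e : I) (b : bool) : {ffun I -> bool} :=
  [ffun i => if i == e then b else sg i].

Lemma set_edge_id sg e : set_edge sg e (sg e) = sg.
Proof. by apply/ffunP => i; rewrite ffunE; case: eqP => [->|]. Qed.

Lemma set_edgeE sg e b : set_edge sg e b e = b.
Proof. by rewrite ffunE eqxx. Qed.

Lemma set_edge2 sg e b c : set_edge (set_edge sg e b) e c = set_edge sg e c.
Proof. by apply/ffunP => i; rewrite !ffunE; case: eqP. Qed.

(** Pairing each configuration with the one that differs from it at e only: the
    sum of the two weights no longer mentions the state of e. *)
Lemma expect_double p f e :
  expect p f + expect p f =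
  \sum_(sg : {ffun I -> bool}) (\prod_(i | i != e) bern (p i) (sg i)) *
    (p e * f (set_edge sg e true) + (1 - p e) * f (set_edge sg e false)).
Proof.
pose flip sg := set_edge sg e (~~ sg e).
have flipK : involutive flip.
  move=> sg; rewrite /flip set_edge2 set_edgeE negbK set_edge_id//.
have {2}-> : expect p f = \sum_(sg : {ffun I -> bool}) weight p (flip sg) * f (flip sg).
  by rewrite /expect (reindex_inj (inv_inj flipK)).
rewrite -big_split /=; apply: eq_bigr => sg _.
have wE b : weight p (set_edge sg e b) =
    bern (p e) b * \prod_(i | i != e) bern (p i) (sg i).
  rewrite /weight (bigD1 e)//= set_edgeE; congr (_ * _).
  by apply: eq_bigr => i /negbTE ie; rewrite ffunE ie.
rewrite /flip wE -{1 2}(set_edge_id sg e) wE.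
by case: (sg e) => /=; ring.
Qed.

Lemma expectE p f e : expect p f =
  expect p (fun sg => p e * f (set_edge sg e true)
                      + (1 - p e) * f (set_edge sg e false)).
Proof.
set g := fun sg => _; suff: expect p f + expect p f = expect p g + expect p g by lra.
rewrite !(expect_double _ _ e); apply: eq_bigr => sg _; congr (_ * _).
by rewrite /g !set_edge2; ring.
Qed.

(** Changing the parameters one edge at a time: by expect_double, the parameter
    of an edge outside A drops out. *)
Lemma expect_local p q (A : pred I) f :
  (forall e, A e -> p e = q e) ->
  (forall sg tau, (forall e, A e -> sg e = tau e) -> f sg = f tau) ->
  expect p f = expect q f.
Proof.
move=> pq floc.
(* q on the edges of S, p elsewhere: S grows to the complement of A. *)
pose mix (S : seq I) e := if e \in S then q e else p e.
suff H S : all (predC A) S -> expect p f = expect (mix S) f.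
  rewrite (H (enum (predC A))); last by apply/allP => e; rewrite mem_enum.
  apply: eq_bigr => sg _; congr (_ * _); apply: eq_bigr => e _; congr bern.
  by rewrite /mix mem_enum inE /= /in_mem/=; case: ifP => // /negbFE /pq.
elim: S => [_|e S IH /= /andP[Ae /IH ->]].
  by apply: eq_bigr.
suff: expect (mix S) f + expect (mix S) f =
  expect (mix (e :: S)) f + expect (mix (e :: S)) f by lra.
rewrite !(expect_double _ _ e); apply: eq_bigr => sg _.
have fe b : f (set_edge sg e b) = f sg.
  apply: floc => i Ai; rewrite ffunE; case: eqP Ai => // -> /(negP Ae)//.
rewrite !fe -!mulrDl !(addrC (mix _ e)) !subrK; congr (_ * _).
apply: eq_bigr => i /negbTE ie; congr bern.
by rewrite /mix inE ie.
Qed.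

Lemma expect_cst p c : expect p (fun=> c) = c.
Proof.
rewrite /expect -mulr_suml.
have -> : \sum_(sg : {ffun I -> bool}) weight p sg = \prod_e \sum_(b : bool) bern (p e) b.
  by rewrite bigA_distr_bigA.
rewrite big1 ?mul1r// => e _; rewrite big_bool /bern /=; ring.
Qed.

Lemma expectD p f g : expect p (fun sg => f sg + g sg) = expect p f + expect p g.
Proof. by rewrite /expect -big_split; apply: eq_bigr => sg _; rewrite mulrDr. Qed.

Lemma expectZ p c f : expect p (fun sg => c * f sg) = c * expect p f.
Proof. by rewrite /expect mulr_sumr; apply: eq_bigr => sg _; rewrite mulrCA. Qed.

Lemma expect_sum p (K : finType) (Q : pred K) (f : K -> {ffun I -> bool} -> R) :
  expect p (fun sg => \sum_(k | Q k) f k sg) = \sum_(k | Q k) expect p (f k).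
Proof.
rewrite /expect exchange_big; apply: eq_bigr => sg _.
by rewrite mulr_sumr.
Qed.

Lemma weight_ge0 p sg : (forall e, 0 <= p e <= 1) -> 0 <= weight p sg.
Proof.
move=> p01; apply: prodr_ge0 => e _.
by have := p01 e; rewrite /bern; case: (sg e); lra.
Qed.

Lemma expect_le p f g : (forall e, 0 <= p e <= 1) ->
  (forall sg, f sg <= g sg) -> expect p f <= expect p g.
Proof.
by move=> p01 fg; apply: ler_sum => sg _; apply: ler_wpM2l; rewrite ?weight_ge0.
Qed.

(* clusters *)
Definition adj sg : rel T := fun x y => [exists e, sg e &&
  ((s e == x) && (t e == y) || (s e == y) && (t e == x))].

Definition component sg (x : T) : {set T} := [set y | connect (adj sg) x y].

Definition touch (e : I) (C : {set T}) := (s e \in C) || (t e \in C).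

Lemma adj_sym sg : symmetric (adj sg).
Proof. by move=> x y; apply/eq_existsb => e; rewrite orbC. Qed.

Lemma component_refl sg x : x \in component sg x.
Proof. by rewrite inE connect0. Qed.

Lemma conn_sym sg : connect_sym (adj sg).
Proof. exact/sym_connect_sym/adj_sym. Qed.

Lemma component_eq sg x y : (component sg x == component sg y) = (y \in component sg x).
Proof.
apply/eqP/idP => [->|]; first exact: component_refl.
rewrite inE => xy; apply/setP => z; rewrite !inE.
exact: (same_connect (@conn_sym sg) xy).
Qed.

Lemma mem_component_sym sg x y : (y \in component sg x) = (x \in component sg y).
Proof. by rewrite !inE conn_sym. Qed.

Lemma component_disj sg x y z : y \notin component sg x ->
  z \in component sg x -> z \notin component sg y.
Proof.
move=> + zx; apply: contra => zy.
by move: zx zy; rewrite -!component_eq => /eqP -> /eqP ->.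
Qed.

(** To certify that a cluster equals C it is enough to look at the edges that
    touch C: those inside C connect it, those leaving C are all closed. *)
Lemma component_local sg tau x C :
  (forall e, touch e C -> sg e = tau e) -> component sg x = C -> component tau x = C.
Proof.
move=> st sC.
have adjE u v : u \in C -> adj sg u v = adj tau u v.
  move=> uC; apply/eq_existsb => e; case: (boolP (touch e C)) => [/st -> //|].
  rewrite negb_or => /andP[sC' tC'].
  have [su|su] := eqVneq (s e) u; first by rewrite su uC in sC'.
  have [tu|tu] := eqVneq (t e) u; first by rewrite tu uC in tC'.
  by rewrite andbF /= !andbF.
have conn u v pth : u \in C -> path (adj tau) u pth -> v = last u pth ->
    v \in C.
  elim: pth u => [|w pth IH] u uC /=; first by move=> _ ->.
  move=> /andP[uw]; apply: IH.
  move: uC uw => /[dup] uC; rewrite -{1}sC inE => xu; rewrite -adjE// => uw.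
  by rewrite -sC inE (connect_trans xu)// connect1.
have xC : x \in C by rewrite -sC component_refl.
apply/setP => y; apply/idP/idP.
  by rewrite inE => /connectP[pth pp lp]; apply: conn xC pp lp.
rewrite -{1}sC inE => /connectP[pth pp ->]; rewrite inE.
elim: pth x xC sC pp => [|w pth IH] x xC sC /=; first by rewrite connect0.
move=> /andP[xw wp]; apply: connect_trans (IH w _ _ wp).
- by apply: connect1; rewrite -adjE.
- by rewrite -sC inE connect1.
- by rewrite -sC; apply/eqP; rewrite eq_sym component_eq inE connect1.
Qed.

(** Change of measure.  On the event that the cluster of x is C, the product
    involves only edges touching C, and turns the weights of those edges into
    the weights of another Bernoulli percolation.  As the event depends on no
    other edge, the sum over C is a total probability for the new parameters.
    This replaces the martingale of a step-by-step exploration of the cluster. *)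
Lemma expect_tilt p (g : I -> bool -> R) x :
  (forall e, p e * g e true + (1 - p e) * g e false = 1) ->
  expect p (fun sg => \prod_(e | touch e (component sg x)) g e (sg e)) = 1.
Proof.
move=> g1.
pose q e := p e * g e true.
have qE e b : bern (q e) b = bern (p e) b * g e b.
  by rewrite /bern /q; case: b => //; have := g1 e; lra.
transitivity (\sum_(C : {set T}) expect q (fun sg => (component sg x == C)%:R)).
  transitivity (\sum_(C : {set T}) expect p (fun sg => (component sg x == C)%:R *
      \prod_(e | touch e C) g e (sg e))).
    rewrite -expect_sum; apply: eq_bigr => sg _; congr (_ * _).
    rewrite (bigD1 (component sg x))//= eqxx mul1r [X in _ + X]big1 ?addr0// => C.
    by rewrite eq_sym => /negbTE ->; rewrite mul0r.
  apply: eq_bigr => C _.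
  pose qC e := if touch e C then q e else p e.
  transitivity (expect qC (fun sg => (component sg x == C)%:R)).
    apply: eq_bigr => sg _; rewrite (mulrC _%:R) mulrA; congr (_ * _).
    rewrite /weight (big_mkcond (touch^~ C)) -big_split /=.
    by apply: eq_bigr => e _; rewrite /qC; case: ifP; rewrite ?qE ?mulr1.
  apply: (@expect_local _ _ (touch^~ C)) => [e|sg tau st].
    by rewrite /qC => ->.
  congr _%:R; congr nat_of_bool.
  by apply/eqP/eqP; apply: component_local => // e /st.
rewrite -expect_sum; transitivity (expect q (fun=> 1)); last exact: expect_cst.
apply: eq_bigr => sg _; congr (_ * _).
rewrite (bigD1 (component sg x))//= eqxx [X in _ + X]big1 ?addr0// => C.
by rewrite eq_sym => /negbTE ->.
Qed.

End FinitePercolation.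

(** * The two-ghost inequality *)

(** Moment generating function of q minus a Bernoulli(q) variable.  The exponent
    is linear in q, like the variance, for every u >= 0 and not only for small
    u, thanks to exp(- u) <= 1 / (1 + u) <= 1 - u + u^2. *)
Lemma mgf_le (R : realType) (q u : R) : 0 <= q <= 1 -> 0 <= u ->
  q * expR (u * (q - 1)) + (1 - q) * expR (u * q) <= expR (q * u ^+ 2).
Proof.
move=> q01 u0.
have eu : expR (- u) <= 1 - u + u ^+ 2.
  have uu := sqr_ge0 u.
  rewrite expRN -[leLHS]mul1r ler_pdivrMr ?expR_gt0//.
  have : 1 <= (1 - u + u ^+ 2) * (1 + u) by have := mulr_ge0 u0 uu; nra.
  by move/le_trans; apply; rewrite ler_wpM2l ?expR_ge1Dx//; nra.
have -> : u * (q - 1) = u * q + - u by ring.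
have -> : q * u ^+ 2 = u * q + q * (- u + u ^+ 2) by ring.
rewrite !expRD; have e0 := expR_gt0 (u * q).
apply: (@le_trans _ _ (expR (u * q) * (1 + q * (- u + u ^+ 2)))).
  have : 0 <= expR (u * q) * (q * (1 - u + u ^+ 2 - expR (- u))).
    by rewrite !mulr_ge0 ?(ltW e0) ?subr_ge0//; lra.
  by rewrite mulrC; lra.
by rewrite ler_pM2l// expR_ge1Dx.
Qed.

Section TwoGhost.
Variables (R : realType) (I T : finType) (s t : I -> T).
Variables (p l : I -> R) (Q : R) (n : nat).
Hypothesis p01 : forall e, 0 <= p e <= 1.
Hypothesis l01 : forall e, 0 <= l e <= 1.
Hypothesis degQ : forall x, \sum_(e | (s e == x) || (t e == x)) l e * p e <= Q.
Notation component := (component s t).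
Notation touch := (touch s t).
Notation conf := {ffun I -> bool}.

Definition centred (e : I) (b : bool) : R := p e - b%:R.

(** Weighted number of closed edges touching the cluster of x, minus its
    compensator when the cluster is explored edge by edge. *)
Definition excess (sg : conf) (x : T) : R :=
  \sum_(e | touch e (component sg x)) l e * centred e (sg e).

Lemma touch_weight (C : {set T}) :
  \sum_(e | touch e C) l e * p e <= Q * #|C|%:R.
Proof.
apply: (@le_trans _ _ (\sum_(x in C) \sum_(e | (s e == x) || (t e == x)) l e * p e)).
  rewrite (exchange_big_dep (touch^~ C))/=; last first.
    by move=> x e xC /orP[]/eqP ex; rewrite /touch ex xC ?orbT.
  apply: ler_sum => e; rewrite /touch => eC.
  have lp0 : 0 <= l e * p e by have := p01 e; have := l01 e; nra.
  have [sC|sC] := boolP (s e \in C).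
    by rewrite (bigD1 (s e)) ?sC ?eqxx//= lerDl sumr_ge0.
  rewrite (negbTE sC) /= in eC.
  by rewrite (bigD1 (t e)) ?eC ?eqxx ?orbT//= lerDl sumr_ge0.
apply: le_trans (ler_sum _ (fun x _ => degQ x)) _.
by rewrite sumr_const mulr_natr.
Qed.

(** In expect_tilt take the factors exp (a l centred), normalised.  By mgf_le the
    normalisation of an edge is at most exp (a^2 l^2 p) <= exp (a^2 l p), and
    the weights l p of the edges touching the cluster add up to at most Q times
    its size. *)
Lemma expect_exp_excess (a : R) x : 0 <= a ->
  expect p (fun sg => expR (a * excess sg x - a ^+ 2 * Q * #|component sg x|%:R)) <= 1.
Proof.
move=> a0.
(* Normalised so that each tilting factor has mean 1. *)
pose M e := p e * expR (a * l e * (p e - 1)) + (1 - p e) * expR (a * l e * p e).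
have M0 e : 0 < M e.
  have e1 := expR_gt0 (a * l e * (p e - 1)); have e2 := expR_gt0 (a * l e * p e).
  by have := p01 e; rewrite /M; nra.
pose g e b := expR (a * l e * centred e b) / M e.
have g1 e : p e * g e true + (1 - p e) * g e false = 1.
  rewrite /g /centred /= subr0 !mulrA -mulrDl divff//.
  by rewrite gt_eqF//; exact: M0.
rewrite -[leRHS](expect_tilt s t x g1); apply: expect_le => // sg.
rewrite expRD expRN /g big_split /= -expR_sum.
rewrite /excess mulr_sumr.
under [X in expR X * _ <= _]eq_bigr do rewrite mulrA.
rewrite ler_pM2l ?expR_gt0// prodfV lef_pV2 ?posrE ?expR_gt0 ?prodr_gt0//.
apply: (@le_trans _ _ (\prod_(e | touch e (component sg x)) expR (a ^+ 2 * (l e * p e)))).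
  apply: ler_prod => e _; rewrite ltW//=.
  apply: le_trans (mgf_le (p01 e) _) _.
    by rewrite mulr_ge0//; have := l01 e; lra.
  rewrite ler_expR exprMn mulrCA ler_wpM2l ?sqr_ge0// mulrC.
  case/andP: (l01 e) => l0 l1; have l1' : 0 <= 1 - l e by lra.
  case/andP: (p01 e) => p0 _.
  by have := mulr_ge0 (mulr_ge0 p0 l0) l1'; lra.
rewrite -expR_sum ler_expR -mulr_sumr -mulrA ler_wpM2l ?sqr_ge0//.
exact: touch_weight.
Qed.

(** Such an edge is closed, since its ends lie in distinct clusters. *)
Definition split_big (sg : conf) (e : I) : bool :=
  [&& t e \notin component sg (s e), (n <= #|component sg (s e)|)%N
    & (n <= #|component sg (t e)|)%N].

(** The sum of min(|C|, n) over the clusters C touched by e; a single cluster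
    is counted once. *)
Definition mass (sg : conf) (e : I) : nat :=
  (minn #|component sg (s e)| n +
   (if t e \in component sg (s e) then 0 else minn #|component sg (t e)| n))%N.

Lemma set_edge_joins sg e : t e \in component (set_edge sg e true) (s e).
Proof.
rewrite inE connect1//; apply/existsP; exists e.
by rewrite set_edgeE !eqxx.
Qed.

Lemma component_set_edge_sub sg e :
  component (set_edge sg e true) (s e) \subset
  component (set_edge sg e false) (s e) :|: component (set_edge sg e false) (t e).
Proof.
set sg1 := set_edge sg e true; set sg0 := set_edge sg e false; set C := _ :|: _.
apply/fintype.subsetP => y; rewrite inE => /connectP[q qp ->].
have sC : s e \in C by rewrite finset.in_setU component_refl.
have tC : t e \in C by rewrite finset.in_setU component_refl orbT.
elim: q (s e) {1}(sC) qp => //= v q IH u uC /andP[/existsP[e' uv]]; apply: IH.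
have [ee|ne] := eqVneq e' e.
  by move: uv; rewrite ee => /andP[_ /orP[/andP[_ /eqP <-]|/andP[/eqP <- _]]].
have uv0 : adj s t sg0 u v.
  by apply/existsP; exists e'; move: uv; rewrite !ffunE (negbTE ne).
by move: uC; rewrite !inE => /orP[]/connect_trans/(_ (connect1 uv0)) ->;
  rewrite ?orbT.
Qed.

(** Opening e merges at most two clusters, and min(|C|, n) is subadditive in
    |C|; if both clusters have at least n vertices the sum drops by n. *)
Lemma mass_set_edge sg e :
  (mass (set_edge sg e true) e + n * split_big (set_edge sg e false) e
   <= mass (set_edge sg e false) e)%N.
Proof.
have h := subset_leq_card (component_set_edge_sub sg e).
rewrite /mass /split_big set_edge_joins addn0.
set sg1 := set_edge sg e true in h *; set sg0 := set_edge sg e false in h *.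
have [ts|ts] := boolP (t e \in component sg0 (s e)).
  move: h; have -> : component sg0 (t e) = component sg0 (s e).
    by apply/eqP; rewrite eq_sym component_eq.
  by rewrite finset.setUid /=; lia.
have := leq_trans h (leq_card_setU _ _).
by rewrite /=; case: leqP => ?; case: leqP => ? /=; lia.
Qed.

Lemma split_big_set_edge sg e : split_big (set_edge sg e true) e = false.
Proof. by rewrite /split_big set_edge_joins. Qed.

(** Conditioning on the other edges: closing e gains p e and opening it loses
    1 - p e, so that only the difference of mass_set_edge survives.  A split
    edge is closed, which supplies the factor 1 - p e. *)
Lemma expect_mass e :
  p e * n%:R * expect p (fun sg => (split_big sg e)%:R) <=
  expect p (fun sg => centred e (sg e) * (mass sg e)%:R).
Proof.
rewrite [in leRHS](expectE _ _ e) [in leLHS](expectE _ _ e) -expectZ.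
apply: expect_le => // sg.
rewrite !set_edgeE split_big_set_edge /centred /= mulr0 add0r subr0.
have : (mass (set_edge sg e true) e)%:R +
    n%:R * (split_big (set_edge sg e false) e)%:R <=
    (mass (set_edge sg e false) e)%:R :> R.
  by rewrite -natrM -natrD ler_nat mass_set_edge.
set m1 := (mass _ _)%:R; set m0 := (mass _ _)%:R; set b := (split_big _ _)%:R.
move=> h; have pp : 0 <= p e * (1 - p e) by have := p01 e; nra.
have -> : p e * n%:R * ((1 - p e) * b) = p e * (1 - p e) * (n%:R * b) by ring.
have -> : p e * ((p e - 1) * m1) + (1 - p e) * (p e * m0) =
  p e * (1 - p e) * (m0 - m1) by ring.
by apply: ler_wpM2l => //; lra.
Qed.

(** Spreads min(|C|, n) evenly over the vertices of the cluster C, so that sums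
    over clusters become sums over vertices. *)
Definition share (sg : conf) (x : T) : R :=
  (minn #|component sg x| n)%:R / #|component sg x|%:R.

Lemma component_card_gt0 sg x : 0 < #|component sg x|%:R :> R.
Proof. by rewrite ltr0n card_gt0; apply/set0Pn; exists x; exact: component_refl. Qed.

Lemma sum_share sg x :
  \sum_(y in component sg x) share sg y = (minn #|component sg x| n)%:R.
Proof.
transitivity (\sum_(y in component sg x) share sg x).
  by apply: eq_bigr => y; rewrite -component_eq /share => /eqP ->.
rewrite sumr_const /share -[LHS]mulr_natr mulfVK//.
by rewrite gt_eqF// component_card_gt0.
Qed.

Lemma mass_share sg e :
  (mass sg e)%:R = \sum_(x | touch e (component sg x)) share sg x.
Proof.
have touchE x : touch e (component sg x) = (x \in component sg (s e)) || (x \in component sg (t e)).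
  by rewrite /touch !(mem_component_sym _ _ _ x).
rewrite /mass natrD -sum_share; have [ts|ts] := boolP (t e \in component sg (s e)).
  rewrite addr0; apply: eq_bigl => x; rewrite touchE.
  suff -> : component sg (t e) = component sg (s e) by rewrite orbb.
  by apply/eqP; rewrite eq_sym component_eq.
rewrite -sum_share [RHS](bigID (mem (component sg (s e)))) /=; congr (_ + _).
  by apply: eq_bigl => x; rewrite touchE andb_idl// => ->.
apply: eq_bigl => x; rewrite touchE andb_orl andbN /=.
rewrite andb_idr// => xt; apply/negP => xs.
by have := component_disj ts xs; rewrite xt.
Qed.

(** Optimising over a gives a bound of order #|T| * sqrt (Q / n) for the
    weighted number of split edges.  The sum over edges of centred times mass
    dominates the left-hand side by expect_mass; regrouped by vertices it is a
    sum of share times excess, and share <= 1, share * |C| <= n let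
    expect_exp_excess bound each term through u <= v + exp(u - v). *)
Lemma two_ghost (a : R) : 0 < a ->
  n%:R * (\sum_e l e * p e * expect p (fun sg => (split_big sg e)%:R)) <=
  #|T|%:R * (a * Q * n%:R + a^-1).
Proof.
move=> a0.
apply: (@le_trans _ _ (expect p (fun sg => \sum_x share sg x * excess sg x))).
  apply: (@le_trans _ _ (expect p (fun sg =>
      \sum_e l e * (centred e (sg e) * (mass sg e)%:R)))).
    rewrite expect_sum mulr_sumr; apply: ler_sum => e _.
    rewrite expectZ mulrCA -!mulrA ler_wpM2l//; first by case/andP: (l01 e).
    by rewrite mulrA; exact: expect_mass.
  apply: expect_le => // sg.
  under eq_bigr do rewrite mass_share mulrA mulr_sumr.
  rewrite (exchange_big_dep predT)//=; apply: ler_sum => x _.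
  by rewrite /excess mulr_sumr; apply: ler_sum => e _; rewrite mulrC.
rewrite expect_sum mulr_natl -sumr_const; apply: ler_sum => x _.
have Q0 : 0 <= Q.
  apply: le_trans (degQ x); apply: sumr_ge0 => e _.
  by have := p01 e; have := l01 e; nra.
have key sg : share sg x * excess sg x <= a * Q * n%:R + a^-1 *
    expR (a * excess sg x - a ^+ 2 * Q * #|component sg x|%:R).
  set E := expR _; set Z := excess sg x.
  have k0 := component_card_gt0 sg x; set k : R := #|component sg x|%:R in k0 E *.
  have zE : a * Z <= a ^+ 2 * Q * k + E.
    by have := expR_ge1Dx (a * Z - a ^+ 2 * Q * k); rewrite -/E; lra.
  have c0 : 0 <= share sg x by rewrite /share divr_ge0.
  have c1 : share sg x <= 1 by rewrite ler_pdivrMr// mul1r ler_nat geq_minl.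
  have ckn : share sg x * k <= n%:R by rewrite mulfVK ?gt_eqF// ler_nat geq_minr.
  have E0 : 0 < E by exact: expR_gt0.
  rewrite -(ler_pM2l a0) mulrDr (mulrA a a^-1) divff ?gt_eqF// mul1r.
  have -> : a * (share sg x * Z) = share sg x * (a * Z) by ring.
  apply: le_trans (ler_wpM2l c0 zE) _; rewrite mulrDr lerD//; last by nra.
  have -> : share sg x * (a ^+ 2 * Q * k) = a ^+ 2 * Q * (share sg x * k) by ring.
  have -> : a * (a * Q * n%:R) = a ^+ 2 * Q * n%:R by ring.
  by rewrite ler_wpM2l// mulr_ge0 ?sqr_ge0.
apply: le_trans (expect_le p01 key) _.
rewrite expectD expect_cst expectZ lerD2l ler_piMr ?invr_ge0 ?(ltW a0)//.
exact/expect_exp_excess/ltW.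
Qed.

End TwoGhost.

(** * Finite-dimensional marginals of the percolation law *)

Section Cylinders.
Variables (V : choiceType) (R : realType) (P : probability (config_space V) R).
Implicit Types (w : config V) (A : {fset edge V}) (B : seq (edge V)).

Definition edge_prob_of (e : edge V) : R := fine (P (edge_open e)).

Lemma measurable_edge_open (e : edge V) :
  measurable (edge_open e : set (config_space V)).
Proof. by apply: sub_sigma_algebra; exists e. Qed.

Lemma edge_prob_ofE (e : edge V) : P (edge_open e) = (edge_prob_of e)%:E.
Proof. by rewrite fineK// fin_num_measure//; exact: measurable_edge_open. Qed.

Definition all_open A : set (config_space V) :=
  [set w | forall e, e \in A -> edge_open e w].

Lemma measurable_all_open A : measurable (all_open A).
Proof.
have -> : all_open A = \bigcap_(e in [set` A]) edge_open e by [].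
by apply: fin_bigcap_measurable => // e _; exact: measurable_edge_open.
Qed.

(** Closed edges are listed by a sequence so that they can be removed one at a
    time, each step being an inclusion-exclusion. *)
Definition cylinder A B : set (config_space V) :=
  all_open A `&` [set w | all (fun e => ~~ w e) B].

Lemma cylinder_cons A b B : cylinder A (b :: B) =
  cylinder A B `\` edge_open b.
Proof.
apply/seteqP; split => w.
  by move=> [wA /= /andP[wb wB]]; split => //; apply/negP.
by move=> [[wA wB] /negP wb]; split => //=; rewrite wb.
Qed.

Lemma measurable_cylinder A B : measurable (cylinder A B).
Proof.
elim: B => [|b B IH].
  rewrite /cylinder (_ : mkset _ = setT) ?setIT; first exact: measurable_all_open.
  by apply/seteqP.
by rewrite cylinder_cons; apply: measurableD => //; exact: measurable_edge_open.
Qed.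

Hypothesis indep : forall A, P (all_open A) = (\prod_(e <- A) P (edge_open e))%E.

Lemma cylinder_prob A B : uniq B -> (forall e, e \in B -> e \notin A) ->
  P (cylinder A B) =
  ((\prod_(e <- A) edge_prob_of e) * \prod_(e <- B) (1 - edge_prob_of e))%:E.
Proof.
elim: B A => [|b B IH] A.
  rewrite /cylinder (_ : [set w | _] = setT) ?setIT => [_ _|]; last exact/seteqP.
  rewrite big_nil mulr1 indep -prodEFin.
  by apply: eq_bigr => e _; rewrite edge_prob_ofE.
move=> /= /andP[bB uB] BA; rewrite cylinder_cons.
have -> : P (cylinder A B `\` edge_open b) =
    (P (cylinder A B) - P (cylinder A B `&` edge_open b))%E.
  apply: measureD; [exact: measurable_cylinder|exact: measurable_edge_open|].
  by rewrite -ge0_fin_numE// fin_num_measure//; exact: measurable_cylinder.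
have -> : cylinder A B `&` edge_open b = cylinder (b |` A)%fset B.
  apply/seteqP; split => w.
    move=> [[wA wB] wb]; split => // e; rewrite in_fset1U => /orP[/eqP -> //|].
    exact: wA.
  move=> [wA wB]; split; last by apply: wA; rewrite in_fset1U eqxx.
  by split => // e eA; apply: wA; rewrite in_fset1U eA orbT.
rewrite !IH//; first last.
- by move=> e eB; apply: BA; rewrite inE eB orbT.
- move=> e eB; rewrite in_fset1U negb_or BA ?inE ?eB ?orbT// andbT.
  by apply: contraNneq bB => <-.
rewrite big_fsetU1/= ?BA ?mem_head// big_cons -EFinB; congr EFin.
by ring.
Qed.

End Cylinders.

Section FiniteModel.
Variables (V : choiceType) (T : finType) (iota : T -> V).
Hypothesis iota_inj : injective iota.

(** Each unordered pair of distinct vertices is represented once, by its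
    increasing orientation for an arbitrary enumeration of T. *)
Definition pairs : finType := {q : T * T | (enum_rank q.1 < enum_rank q.2)%N}.
Definition src (e : pairs) : T := (val e).1.
Definition tgt (e : pairs) : T := (val e).2.

Lemma src_neq_tgt (e : pairs) : src e != tgt e.
Proof. by apply: contraTneq (valP e) => h; rewrite -/(src e) -/(tgt e) h ltnn. Qed.

Lemma pairs_total (x y : T) : x != y ->
  exists e : pairs, (src e = x /\ tgt e = y) \/ (src e = y /\ tgt e = x).
Proof.
move=> xy; have [h|h|/ord_inj/enum_rank_inj h] := ltngtP (enum_rank x) (enum_rank y).
- by exists (exist _ (x, y) h); left.
- by exists (exist _ (y, x) h); right.
- by rewrite h eqxx in xy.
Qed.

Lemma image_card (e : pairs) : #|` [fset iota (src e); iota (tgt e)]%fset| == 2.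
Proof. by rewrite cardfs2 (inj_eq iota_inj) src_neq_tgt. Qed.

Definition image_edge (e : pairs) : edge V :=
  exist (fun e : {fset V} => #|` e| == 2) _ (image_card e).

Lemma image_edge_inj : injective image_edge.
Proof.
move=> e f /(congr1 val) /= /fsetP ef.
have := ef (iota (src e)); have := ef (iota (tgt e)).
rewrite !in_fset2 !(inj_eq iota_inj) !eqxx orbT /=.
move=> /esym/orP[]/eqP te /esym/orP[]/eqP se.
- by have := src_neq_tgt e; rewrite te se eqxx.
- by have := valP e; have := valP f; rewrite -/(src e) -/(src f) -/(tgt e) -/(tgt f)
    te se /= => h /(ltn_trans h); rewrite ltnn.
- by apply/val_inj; rewrite (surjective_pairing (val e)) (surjective_pairing (val f))
    -/(src e) -/(src f) -/(tgt e) -/(tgt f) te se.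
- by have := src_neq_tgt e; rewrite te se eqxx.
Qed.

(** Finite sets of vertices are given by an injection iota of a finite type.
    The law of this configuration depends on the kernel only through its values
    along iota, which makes invariance under automorphisms immediate. *)
Definition local_config (w : config V) : {ffun pairs -> bool} :=
  [ffun e => w (image_edge e)].

Lemma joined_sym (w : config V) x y : joined w x y = joined w y x.
Proof. by rewrite /joined fsetUC. Qed.

Lemma joined_irr (w : config V) x : joined w x x = false.
Proof. by rewrite /joined insubF// cardfs2 eqxx. Qed.

Lemma joined_image w (e : pairs) :
  joined w (iota (src e)) (iota (tgt e)) = w (image_edge e).
Proof.
rewrite /joined (insubT (fun e : {fset V} => #|` e| == 2) (image_card e)).
by congr w; apply: val_inj.
Qed.

Lemma adj_local_config w x y :
  adj src tgt (local_config w) x y = joined w (iota x) (iota y).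
Proof.
have [->|xy] := eqVneq x y.
  rewrite joined_irr; apply/negbTE/negP => /existsP[e /andP[_]].
  by rewrite orbb => /andP[/eqP h1 /eqP h2]; have := src_neq_tgt e; rewrite h1 h2 eqxx.
apply/existsP/idP => [[e /andP[]]|wxy].
  rewrite ffunE -joined_image => we /orP[]/andP[/eqP <- /eqP <-]//.
  by rewrite joined_sym.
have [e he] := pairs_total xy; exists e; rewrite ffunE -joined_image.
by case: he => -[-> ->]; rewrite !eqxx ?orbT ?andbT// joined_sym.
Qed.

Variables (R : realType) (J : V -> V -> R) (beta : R).

Definition pair_prob (e : pairs) : R :=
  1 - expR (- (beta * J (iota (src e)) (iota (tgt e)))).

Variable P : probability (config_space V) R.
Hypothesis hP : percolation_law J beta P.

Lemma edge_prob_image e : edge_prob_of P (image_edge e) = pair_prob e.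
Proof.
rewrite /edge_prob_of; have -> : edge_open (image_edge e) =
    [set w | joined w (iota (src e)) (iota (tgt e))].
  by apply/seteqP; split => w /=; rewrite joined_image.
by rewrite (edge_prob hP)// (inj_eq iota_inj) src_neq_tgt.
Qed.

Lemma local_config_eq sg : [set w : config_space V | local_config w = sg] =
  cylinder [fset image_edge e | e in [pred e | sg e]]%fset
    [seq image_edge e | e <- enum [pred e | ~~ sg e]].
Proof.
apply/seteqP; split => w.
  move=> <-; split.
    by move=> _ /imfsetP[e /= + ->]; rewrite -topredE /= ffunE.
  rewrite /=; apply/allP => _ /mapP[e + ->].
  by rewrite mem_enum -topredE /= ffunE.
move=> [wA /allP wB]; apply/ffunP => e; rewrite ffunE.
have [se|se] := boolP (sg e).
  by apply: wA; apply/imfsetP; exists e.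
apply/negbTE/wB/map_f; by rewrite mem_enum.
Qed.

Lemma measurable_local_config (A : pred {ffun pairs -> bool}) :
  measurable [set w : config_space V | A (local_config w)].
Proof.
have -> : [set w : config_space V | A (local_config w)] =
    \bigcup_(sg in [set sg | A sg]) [set w | local_config w = sg].
  by apply/seteqP; split => w /=; [exists (local_config w)|case=> sg /= + ->].
apply: fin_bigcup_measurable => [|sg _]; first exact: finite_finset.
by rewrite local_config_eq; exact: measurable_cylinder.
Qed.

Lemma local_config_prob sg :
  P [set w : config_space V | local_config w = sg] = (weight pair_prob sg)%:E.
Proof.
rewrite local_config_eq cylinder_prob.
- congr EFin; rewrite big_imfset/=; last by move=> ? ? _ _; exact: image_edge_inj.
  rewrite big_map /= /weight [RHS](bigID (fun e => sg e)) /=; congr (_ * _).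
    rewrite (perm_big (enum [pred e | sg e])); last first.
      by apply: uniq_perm => [||e]; rewrite ?enum_finmem_uniq ?enum_uniq//.
    rewrite big_enum; apply: eq_big => [e|e]; first by rewrite -topredE.
    by rewrite -topredE /= => se; rewrite edge_prob_image se.
  rewrite big_enum; apply: eq_big => [e|e]; first by rewrite -topredE.
  by rewrite -topredE /= => /negbTE se; rewrite edge_prob_image se.
- exact: edge_indep hP.
- by rewrite map_inj_uniq ?enum_uniq//; exact: image_edge_inj.
- move=> _ /mapP[e + ->]; rewrite mem_enum -topredE /= => /negP se.
  by apply/negP => /imfsetP[f /= + /image_edge_inj ef]; rewrite -topredE /= -ef.
Qed.

Lemma local_config_expect (A : pred {ffun pairs -> bool}) :
  P [set w : config_space V | A (local_config w)] =
  (expect pair_prob (fun sg => (A sg)%:R))%:E.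
Proof.
have -> : [set w : config_space V | A (local_config w)] =
    \bigcup_(sg in [set sg | A sg]) [set w | local_config w = sg].
  by apply/seteqP; split => w /=; [exists (local_config w)|case=> sg /= + ->].
rewrite measure_fin_bigcup; last 3 first.
- exact: finite_finset.
- by move=> sg tau _ _ [w [/= -> ->]].
- by move=> sg _; rewrite local_config_eq; exact: measurable_cylinder.
rewrite (fsbigE (enum A)); last 3 first.
- exact: enum_uniq.
- by move=> sg /=; rewrite mem_enum.
- by move=> sg /= Asg; rewrite mem_enum => /negP.
transitivity (\sum_(sg | A sg) (weight pair_prob sg)%:E)%E.
  rewrite big_enum_cond /=; apply: eq_big => sg; last by rewrite local_config_prob.
  by rewrite -topredE /= andb_idr// => /mem_set.
rewrite sumEFin; congr EFin; rewrite /expect [RHS](bigID A) /=.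
rewrite [X in _ = _ + X]big1 ?addr0 => [|sg /negbTE ->]; last by rewrite mulr0.
by apply: eq_bigr => sg ->; rewrite mulr1.
Qed.

End FiniteModel.

(** * Distances, automorphisms and balls *)

Section Geometry.
Variables (V : choiceType) (E : rel V).
Hypothesis hG : infinite_graph E.
Notation dist := (graph_dist E).

Lemma graph_dist_spec x y : connected_by E x y (dist x y) /\
  forall m, connected_by E x y m -> (dist x y <= m)%N.
Proof.
suff [n hn] : exists n, connected_by E x y n /\
    forall m, connected_by E x y m -> (n <= m)%N.
  by rewrite /graph_dist; case: xgetP => [k -> //|/(_ n)].
have [n0 hn0] := graph_connected hG x y.
have ex : exists n, `[< connected_by E x y n >] by exists n0; apply/asboolP.
exists (ex_minn ex); case: ex_minnP => n /asboolP hn nmin; split => // m hm.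
by apply: nmin; apply/asboolP.
Qed.

Lemma connected_dist x y : connected_by E x y (dist x y).
Proof. by have [] := graph_dist_spec x y. Qed.

Lemma dist_le x y m : connected_by E x y m -> (dist x y <= m)%N.
Proof. by have [_] := graph_dist_spec x y; apply. Qed.

Lemma dist_refl x : dist x x = 0%N.
Proof. by apply/eqP; rewrite -leqn0; apply: dist_le; exists [::]. Qed.

Lemma dist_triangle x y z : (dist x z <= dist x y + dist y z)%N.
Proof.
apply: dist_le; have [p [pp lp sp]] := connected_dist x y.
have [q [pq lq sq]] := connected_dist y z.
by exists (p ++ q); rewrite cat_path last_cat size_cat pp lp pq lq sp sq.
Qed.

Lemma dist_sym x y : dist x y = dist y x.
Proof.
suff H a b : (dist a b <= dist b a)%N by apply/eqP; rewrite eqn_leq !H.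
apply: dist_le; have [p [pp lp sp]] := connected_dist b a.
exists (rev (belast b p)); split.
- rewrite -lp rev_path (eq_path (e' := E))//.
  by move=> u v; rewrite (graph_sym hG).
- by case: p pp lp sp => //= c p _ _ _; rewrite rev_cons last_rcons.
- by rewrite size_rev size_belast.
Qed.

Lemma automorphism_inj g : graph_automorphism E g -> injective g.
Proof. by case=> /bij_inj. Qed.

Lemma dist_automorphism g x y : graph_automorphism E g ->
  dist (g x) (g y) = dist x y.
Proof.
have le h a b : graph_automorphism E h -> (dist (h a) (h b) <= dist a b)%N.
  move=> [_ hE]; apply: dist_le; have [p [pp lp sp]] := connected_dist a b.
  exists [seq h z | z <- p]; rewrite last_map lp size_map; split => //.
  by rewrite path_map (eq_path (e' := E)).
move=> /[dup] ga [[h gh hg] gE]; apply/eqP; rewrite eqn_leq le//=.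
rewrite -{1}(gh x) -{1}(gh y); apply: le; split; first by exists g.
by move=> u v; rewrite -gE !hg.
Qed.

End Geometry.

Section Balls.
Variables (R : realType) (V : choiceType) (E : rel V) (o : V) (d : nat).
Hypothesis hG : infinite_graph E.
Hypothesis htrans : transitive_graph E.
Hypothesis hdim : growth_dimension E R o d.
Notation dist := (graph_dist E).

Lemma finite_graph_ball x r : finite_set (graph_ball E x r).
Proof.
have fo : finite_set (graph_ball E o r.+1).
  have [c [C [c0 _ /(_ r.+1 isT)/andP[+ _]]]] := hdim.
  apply: contraPP => infB.
  have -> : fset_set (graph_ball E o r.+1) = fset0%fset.
    by rewrite /fset_set; case: pselect.
  by apply/negP; rewrite cardfs0 -ltNge mulr_gt0// exprn_gt0.
have [g ga gx] := htrans o x.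
apply: sub_finite_set (finite_image g fo) => y; rewrite /graph_ball /= => xy.
have [[h gh hg] _] := ga; exists (h y); last exact: hg.
by rewrite /= -(dist_automorphism hG _ _ ga) gx hg (leq_trans xy).
Qed.

Definition gball (x : V) (r : nat) : {fset V} := fset_set (graph_ball E x r).

Lemma in_gball x r y : (y \in gball x r) = (dist x y <= r)%N.
Proof.
rewrite /gball in_fset_set; last exact: finite_graph_ball.
by apply/idP/idP => [/set_mem//|xy]; apply/mem_set.
Qed.

Definition volume (r : nat) : nat := #|` gball o r|.

Lemma card_gball x r : #|` gball x r| = volume r.
Proof.
have le a b : (#|` gball a r| <= #|` gball b r|)%N.
  have [g ga gx] := htrans a b.
  rewrite -(size_map g); apply: uniq_leq_size.
    by rewrite (map_inj_uniq (automorphism_inj ga)) fset_uniq.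
  by move=> _ /mapP[y + ->]; rewrite !in_gball -gx (dist_automorphism hG).
by apply/eqP; rewrite eqn_leq !le.
Qed.

Lemma volume_mono r r' : (r <= r')%N -> (volume r <= volume r')%N.
Proof.
move=> rr; apply: fsubset_leq_card; apply/fsubsetP => y.
by rewrite !in_gball => /leq_trans; apply.
Qed.

Lemma volume_gt0 r : (0 < volume r)%N.
Proof.
by rewrite cardfs_gt0; apply/fset0Pn; exists o; rewrite in_gball dist_refl.
Qed.

Lemma card_near (T : finType) (iota : T -> V) (S : {set T}) x r :
  injective iota -> {in S, forall y, dist x (iota y) <= r}%N ->
  (#|S| <= volume r)%N.
Proof.
move=> inj Sr; rewrite -(card_gball x) cardE -(size_map iota).
apply: uniq_leq_size; first by rewrite map_inj_uniq ?enum_uniq.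
move=> _ /mapP[y + ->]; rewrite mem_enum => /Sr.
by rewrite -in_gball.
Qed.

End Balls.

(** * Clusters inside a finite set of vertices *)

Section LargeProb.
Variables (R : realType) (V : choiceType) (J : V -> V -> R) (beta : R).

Definition large_prob (T : finType) (iota : T -> V) (x : T) (n : nat) : R :=
  expect (pair_prob iota J beta)
    (fun sg => (n <= #|component (@src T) (@tgt T) sg x|)%N%:R).

Variable P : probability (config_space V) R.
Hypothesis hP : percolation_law J beta P.

Definition large_event (T : finType) (iota : T -> V) (inj : injective iota)
  (x : T) (n : nat) : set (config_space V) :=
  [set w | (n <= #|component (@src T) (@tgt T) (local_config inj w) x|)%N].

Lemma measurable_large_event T iota inj x n :
  measurable (@large_event T iota inj x n).
Proof.
exact: (measurable_local_config inj
  (fun sg => n <= #|component (@src T) (@tgt T) sg x|)%N).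
Qed.

Lemma large_eventE T iota inj x n :
  P (@large_event T iota inj x n) = (large_prob iota x n)%:E.
Proof.
exact: (local_config_expect inj hP
  (fun sg => n <= #|component (@src T) (@tgt T) sg x|)%N).
Qed.

Lemma component_embed (T T' : finType) (iota : T -> V) (iota' : T' -> V)
    (inj : injective iota) (inj' : injective iota') x x' (w : config V) :
  (forall t, exists t', iota' t' = iota t) -> iota' x' = iota x ->
  (#|component (@src T) (@tgt T) (local_config inj w) x| <=
   #|component (@src T') (@tgt T') (local_config inj' w) x'|)%N.
Proof.
move=> /choice[k ik] xx.
have kx : k x = x' by apply: inj'; rewrite ik.
have kinj : injective k by move=> a b ab; apply: inj; rewrite -!ik ab.
rewrite -(card_imset _ kinj); apply: subset_leq_card.
apply/fintype.subsetP => _ /imsetP[y + ->]; rewrite !inE -kx.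
move=> /connectP[p pp ->]; elim: p x {xx kx} pp => [|z p IH] x /=.
  by rewrite connect0.
move=> /andP[xz /IH]; apply: connect_trans; apply: connect1.
by rewrite adj_local_config !ik -(adj_local_config inj).
Qed.

Lemma large_event_embed (T T' : finType) (iota : T -> V) (iota' : T' -> V)
    (inj : injective iota) (inj' : injective iota') x x' n :
  (forall t, exists t', iota' t' = iota t) -> iota' x' = iota x ->
  large_event inj x n `<=` large_event inj' x' n.
Proof.
by move=> emb xx w /leq_trans; apply; apply: component_embed.
Qed.

Lemma large_prob_ge0 T iota (inj : injective iota) x n :
  0 <= @large_prob T iota x n.
Proof. by rewrite -lee_fin -(large_eventE inj). Qed.

(** Transport by an automorphism does not change the law, and enlarging the
    vertex set can only enlarge the cluster. *)
Lemma large_prob_embed (E : rel V) (hJ : transitive_kernel E J)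
    (T T' : finType) (iota : T -> V) (iota' : T' -> V) g x x' n :
  injective iota -> injective iota' -> graph_automorphism E g ->
  (forall t, exists t', iota' t' = g (iota t)) -> iota' x' = g (iota x) ->
  large_prob iota x n <= large_prob iota' x' n.
Proof.
move=> inj inj' ga emb xx.
have injg : injective (g \o iota).
  by apply: inj_comp => //; exact: automorphism_inj ga.
have -> : large_prob iota x n = large_prob (g \o iota) x n.
  apply: eq_bigr => sg _; congr (_ * _); apply: eq_bigr => e _; congr bern.
  by rewrite /pair_prob /= (kernel_trans hJ).
rewrite -lee_fin -(large_eventE injg) -(large_eventE inj').
apply: le_measure; rewrite ?inE; try exact: measurable_large_event.
exact: large_event_embed.
Qed.

End LargeProb.

(** * Clusters of intermediate size have split pairs *)

Section Merging.
Local Open Scope set_scope.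
Variables (R : realType) (V : choiceType) (E : rel V) (o : V) (d : nat).
Hypothesis hG : infinite_graph E.
Hypothesis htrans : transitive_graph E.
Hypothesis hdim : growth_dimension E R o d.
Notation dist := (graph_dist E).
Notation volume := (volume E o).
Notation gball := (gball E).

(** Count the pairs (x, z) with x in A and z within distance r of x.  Two
    points of A near the same z are within distance 2r of each other, so each z
    sees at most m of them. *)
Lemma low_density (T : finType) (iota : T -> V) (A U : {set T}) (k r m : nat) :
  injective iota -> (forall t, iota t \in gball o k) -> A \subset U ->
  {in A, forall x, #|[set y in U | dist (iota x) (iota y) <= r.*2]%N| <= m}%N ->
  (#|A| * volume r <= volume (k + r) * m)%N.
Proof.
move=> inj inB /fintype.subsetP AU Am; pose T' := gball o (k + r).
have volE x : volume r = (\sum_(z : T') (dist (iota x) (val z) <= r))%N.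
  transitivity #|[set z : T' | dist (iota x) (val z) <= r]%N|; last first.
    by rewrite -sum1_card big_mkcond; apply: eq_bigr => z _; rewrite inE; case: ifP.
  rewrite -(card_gball hG htrans hdim (iota x)) cardE -(size_map val).
  apply: perm_size; apply: uniq_perm => [||z].
  - exact: fset_uniq.
  - by rewrite map_inj_uniq ?enum_uniq//; exact: val_inj.
  apply/idP/mapP => [|[y + ->]]; last first.
    by rewrite mem_enum inE => xy; rewrite (in_gball hG htrans hdim).
  rewrite (in_gball hG htrans hdim) => xz.
  have zT : z \in T'.
    rewrite (in_gball hG htrans hdim).
    apply: leq_trans (dist_triangle hG _ (iota x) _) (leq_add _ xz).
    by have := inB x; rewrite (in_gball hG htrans hdim).
  by exists [` zT]%fset => //; rewrite mem_enum inE.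
have volT : volume (k + r) = #|{: T'}| by rewrite -cardfE.
rewrite volT -sum_nat_const -sum_nat_const.
under eq_bigr => x _ do rewrite (volE x).
rewrite exchange_big /=; apply: leq_sum => z _.
have -> : (\sum_(x in A) (dist (iota x) (val z) <= r))%N =
    #|[set x in A | dist (iota x) (val z) <= r]%N|.
  rewrite -sum1_card big_mkcond [RHS]big_mkcond; apply: eq_bigr => x _.
  by rewrite inE; do 2 case: ifP => //.
have [->|/finset.set0Pn[x]] := eqVneq [set x in A | dist (iota x) (val z) <= r]%N finset.set0.
  by rewrite cards0.
rewrite inE => /andP[xA xz]; apply: leq_trans (Am x xA).
apply: subset_leq_card; apply/fintype.subsetP => y; rewrite !inE => /andP[yA yz].
rewrite AU//= -addnn; apply: leq_trans (dist_triangle hG _ (val z) _) (leq_add xz _).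
by rewrite dist_sym.
Qed.

Section Counting.
Variables (T : finType) (iota : T -> V) (k r rho m n n' : nat).
Hypothesis inj : injective iota.
Hypothesis inB : forall t, iota t \in gball o k.
Hypothesis rho_small : (4 * volume rho <= m)%N.
Hypothesis n'_small : (4 * n' <= m)%N.
Variable sg : {ffun pairs T -> bool}.
Notation C := (component (@src T) (@tgt T) sg).

Definition long_pair (x y : T) : bool := (rho < dist (iota x) (iota y) <= r.*2)%N.

Lemma count_ordered (B : {set T * T}) (b : pred (pairs T)) :
  (forall x y, (x, y) \in B -> x != y) ->
  (forall e, ((src e, tgt e) \in B) || ((tgt e, src e) \in B) -> b e) ->
  (#|B| <= 2 * \sum_e b e)%N.
Proof.
move=> irr Bb; pose Eb := [set e | b e].
have -> : (\sum_e b e = #|Eb|)%N.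
  by rewrite -sum1_card [RHS]big_mkcond; apply: eq_bigr => e _; rewrite inE; case: ifP.
rewrite mul2n -addnn.
have BE : B \subset [set (src e, tgt e) | e in Eb] :|: [set (tgt e, src e) | e in Eb].
  apply/fintype.subsetP => -[x y] xyB; have [e he] := pairs_total (irr _ _ xyB).
  have eb : e \in Eb by rewrite inE; apply: Bb; case: he => -[-> ->]; rewrite xyB ?orbT.
  by rewrite finset.in_setU; case: he => -[<- <-]; rewrite imset_f ?orbT//
    (imset_f (fun e => (tgt e, src e))) ?orbT.
apply: leq_trans (subset_leq_card BE) (leq_trans (leq_card_setU _ _) _).
by apply: leq_add; exact: leq_imset_card.
Qed.

(** The first term accounts for vertices with at most m neighbours in large
    clusters.  Any other vertex of a cluster of size in [n, n') has more than m
    such neighbours, of which at most m / 4 are too close and at most m / 4 are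
    in its own cluster, so that at least m / 2 of them form split pairs with
    it; each split pair is found from its two ends. *)
Lemma count_medium :
  (#|[set x | n <= #|C x| < n']%N| * volume r * m <=
   volume (k + r) * m * m +
   4 * volume r * \sum_(e | long_pair (src e) (tgt e)) split_big (@src T) (@tgt T) n sg e)%N.
Proof.
set U0 := [set x | _]; pose U := [set x | n <= #|C x|]%N.
pose nb x := [set y in U | dist (iota x) (iota y) <= r.*2]%N.
pose W := [set x in U0 | #|nb x| <= m]%N.
have hW : (#|W| * volume r <= volume (k + r) * m)%N.
  apply: (low_density (U := U)) inj inB _ _.
    by apply/fintype.subsetP => x; rewrite !inE => /andP[/andP[]].
  by move=> x; rewrite inE => /andP[].
pose B := [set q : T * T | [&& n <= #|C q.1|, n <= #|C q.2|, long_pair q.1 q.2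
  & q.2 \notin C q.1]%N].
have inBE x y : ((x, y) \in B) =
    [&& n <= #|C x|, n <= #|C y|, long_pair x y & y \notin C x]%N.
  by rewrite finset.in_set.
have hB : (#|B| <= 2 * \sum_(e | long_pair (src e) (tgt e))
    split_big (@src T) (@tgt T) n sg e)%N.
  rewrite big_mkcond (eq_bigr (fun e => (long_pair (src e) (tgt e) &&
      split_big (@src T) (@tgt T) n sg e : nat))); last by move=> e _; case: ifP.
  apply: count_ordered => [x y|e]; rewrite !inBE.
    by case/and4P => _ _ _; apply: contraNneq => ->; exact: component_refl.
  rewrite /split_big; case/orP => /and4P[h1 h2 h3 h4]; first by rewrite h1 h2 h3 h4.
  rewrite /long_pair (dist_sym hG) -/(long_pair _ _) h3 h2 h1.
  by rewrite mem_component_sym h4.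
have hG' : (#|U0 :\: W| * m <= 2 * #|B|)%N.
  have -> : #|B| = (\sum_x #|[set y | (x, y) \in B]|)%N.
    transitivity (\sum_x \sum_y ((x, y) \in B))%N.
      rewrite pair_big -sum1_card big_mkcond; apply: eq_bigr => -[x y] _ /=.
      by case: ifP.
    apply: eq_bigr => x _; rewrite -sum1_card [RHS]big_mkcond.
    by apply: eq_bigr => y _; rewrite finset.in_set; case: ifP.
  rewrite -sum_nat_const big_distrr /= big_mkcond; apply: leq_sum => x _.
  case: ifP => //; rewrite finset.in_setD => /andP[+ xU].
  rewrite finset.in_set xU /= -ltnNge => hm.
  move: xU; rewrite finset.in_set => /andP[xn xn'].
  have : nb x \subset [set y | (x, y) \in B] :|:
      ([set y | dist (iota x) (iota y) <= rho]%N :|: C x).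
    apply/fintype.subsetP => y; rewrite !finset.in_setU [y \in nb x]finset.in_set => /andP[].
    rewrite [y \in U]finset.in_set => yn xy;
    have [//|yx] := boolP (y \in C x); first by rewrite !orbT.
    rewrite [y \in [set z | (x, z) \in B]]finset.in_set inBE xn yn /long_pair xy yx /=.
    by rewrite !andbT orbF [y \in _]finset.in_set ltnNge orNb.
  move=> /subset_leq_card h1.
  have [h2 _] := leq_card_setU [set y | (x, y) \in B]
      ([set y | dist (iota x) (iota y) <= rho]%N :|: C x).
  have [h3 _] := leq_card_setU [set y | dist (iota x) (iota y) <= rho]%N (C x).
  have h4 : (#|[set y | dist (iota x) (iota y) <= rho]%N| <= volume rho)%N.
    by apply: (card_near hG htrans hdim (x := iota x) inj) => y; rewrite inE.
  have := leq_trans hm (leq_trans (leq_trans h1 h2)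
    (leq_add (leqnn _) (leq_trans h3 (leq_add h4 (ltnW xn'))))).
  move: rho_small n'_small; move: #|[set y | (x, y) \in B]| => b; lia.
have hU : (#|U0| <= #|W| + #|U0 :\: W|)%N.
  have WU : W \subset U0 by apply/fintype.subsetP => x; rewrite inE => /andP[].
  by rewrite cardsD (finset.setIidPr WU) subnKC ?subset_leq_card.
set S := (\sum_(e | _) _)%N in hB *.
have hS : (#|U0 :\: W| * m <= 4 * S)%N by lia.
have : (#|U0| * volume r * m <= (#|W| + #|U0 :\: W|) * volume r * m)%N.
  by rewrite !leq_mul2r hU !orbT.
have h1 : (#|W| * volume r * m <= volume (k + r) * m * m)%N.
  by rewrite leq_mul2r hW orbT.
have h2 : (volume r * (#|U0 :\: W| * m) <= volume r * (4 * S))%N.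
  by rewrite leq_mul2l hS orbT.
by move: h1 h2; nia.
Qed.

End Counting.
End Merging.

(** * Comparison of cluster-size tails *)

Lemma expr_unbounded (R : realType) (q C : R) : 1 < q -> exists i, C < q ^+ i.
Proof.
move=> q1; have bern i : 1 + i%:R * (q - 1) <= q ^+ i.
  elim: i => [|i IH]; first by rewrite mul0r addr0 expr0.
  rewrite exprS; apply: (@le_trans _ _ (q * (1 + i%:R * (q - 1)))); last first.
    by rewrite ler_wpM2l//; lra.
  have := mulr_ge0 (ler0n R i) (sqr_ge0 (q - 1)); rewrite -natr1; lra.
exists (Num.bound `|(C - 1) / (q - 1)|); apply: lt_le_trans (bern _).
have := le_lt_trans (ler_norm _) (archi_boundP (normr_ge0 ((C - 1) / (q - 1)))).
by rewrite ltr_pdivrMr ?subr_gt0//; lra.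
Qed.

Section Step.
Variables (R : realType) (V : choiceType) (E : rel V) (o : V) (d : nat).
Hypothesis hG : infinite_graph E.
Hypothesis htrans : transitive_graph E.
Hypothesis hdim : growth_dimension E R o d.
Notation dist := (graph_dist E).
Notation volume := (volume E o).
Notation gball := (gball E).

Lemma volume_doubling : exists2 C : R, 0 < C &
  forall k, (0 < k)%N -> (volume k.*2)%:R <= C * (volume k)%:R.
Proof.
have [c [C [c0 C0 h]]] := hdim; exists (C / c * 2 ^+ d).
  by rewrite mulr_gt0 ?divr_gt0 ?exprn_gt0.
move=> k k0; have /andP[_ h2] := h k.*2 (etrans (double_gt0 k) k0).
have /andP[h1 _] := h k k0.
apply: le_trans h2 _; rewrite -muln2 natrM exprMn.
have -> : C * (k%:R ^+ d * 2 ^+ d) = C / c * 2 ^+ d * (c * k%:R ^+ d).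
  by field; rewrite gt_eqF.
by rewrite ler_wpM2l// mulr_ge0 ?divr_ge0 ?exprn_ge0// ltW.
Qed.

(** Otherwise the volume would grow by the factor x / y > 1 every s steps;
    after i steps this contradicts the doubling of the volume from radius
    k + i s to twice that radius. *)
Lemma folner (x y : R) (s k0 : nat) : 0 <= y ->
  (forall k, (k0 <= k)%N -> x * (volume k)%:R <= y * (volume (k + s))%:R) ->
  x <= y.
Proof.
move=> y0 h; rewrite leNgt; apply/negP => yx.
have x0 : 0 <= x by lra.
have vol0 k : 0 < (volume k)%:R :> R by rewrite ltr0n (volume_gt0 hG htrans hdim).
have hi k i : (k0 <= k)%N ->
    x ^+ i * (volume k)%:R <= y ^+ i * (volume (k + i * s))%:R.
  move=> kk; elim: i => [|i IH]; first by rewrite mul0n addn0 !expr0.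
  rewrite !exprS -!mulrA; apply: (@le_trans _ _ (x * (y ^+ i * (volume (k + i * s))%:R))).
    by rewrite ler_wpM2l.
  rewrite mulrCA [leRHS]mulrCA ler_wpM2l ?exprn_ge0//.
  by rewrite mulSn (addnC s) addnA; apply: h; rewrite (leq_trans kk)// leq_addr.
have [C C0 hC] := volume_doubling.
have hb i : x ^+ i <= C * y ^+ i.
  pose k := (k0.+1 + i * s)%N.
  rewrite -(ler_pM2r (vol0 k)) (mulrC C) -mulrA.
  apply: le_trans (hi k i _) _; first by rewrite /k addSn -addnS leq_addr.
  rewrite ler_wpM2l ?exprn_ge0//; apply: le_trans (hC k _); last by rewrite /k addSn.
  rewrite ler_nat; apply: (volume_mono hG htrans hdim).
  by rewrite -addnn /k; lia.
have [ye|yn] := eqVneq y 0.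
  by have := hb 1%N; rewrite ye !expr1 mulr0; lra.
have yp : 0 < y by rewrite lt_neqAle eq_sym yn.
have [|i] := @expr_unbounded R (x / y) C; first by rewrite ltr_pdivlMr// mul1r.
by rewrite expr_div_n ltr_pdivlMr ?exprn_gt0// ltNge hb.
Qed.

Variables (J : V -> V -> R) (beta : R) (P : probability (config_space V) R).
Hypothesis hJ : transitive_kernel E J.
Hypothesis beta0 : 0 <= beta.
Hypothesis hP : percolation_law J beta P.

Lemma pair_prob01 (T : finType) (iota : T -> V) e : 0 <= pair_prob iota J beta e <= 1.
Proof.
rewrite /pair_prob; set u := beta * _.
have u0 : 0 <= u by rewrite mulr_ge0// (kernel_ge0 hJ).
have := expR_gt0 (- u); have : expR (- u) <= 1 by rewrite -expR0 ler_expR oppr_le0.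
by lra.
Qed.

Section Merge.
Variables (k r rho m n n' : nat) (a p0 : R).
Hypothesis rho_small : (4 * volume rho <= m)%N.
Hypothesis n'_small : (4 * n' <= m)%N.
Hypothesis n_gt0 : (0 < n)%N.
Hypothesis a_gt0 : 0 < a.
Hypothesis p0_gt0 : 0 < p0.
Hypothesis long_prob : forall x y, (rho < dist x y <= r.*2)%N ->
  p0 <= 1 - expR (- (beta * J x y)).

Notation T := (gball o k).
Notation iota := (val : T -> V).
Notation p := (pair_prob iota J beta).
Notation long e := (long_pair E iota r rho (src e) (tgt e)).

Lemma long_degree (x : T) :
  (#|[set e : pairs T | ((src e == x) || (tgt e == x)) && long e]%SET| <=
   volume r.*2)%N.
Proof.
(* Sends a pair containing x to its other end. *)
set S := finset _; pose other (e : pairs T) := if src e == x then tgt e else src e.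
rewrite -(@card_in_imset _ _ other); last first.
  move=> e f; rewrite !inE /other => /andP[+ _] /andP[+ _].
  have ne := valP e; have nf := valP f.
  rewrite -/(src e) -/(tgt e) -/(src f) -/(tgt f) /= in ne nf.
  move=> he hf ef; apply: val_inj.
  rewrite (surjective_pairing (val e)) (surjective_pairing (val f)).
  rewrite -/(src e) -/(tgt e) -/(src f) -/(tgt f).
  move: he hf ef; have [<-|/= _ /eqP te] := eqVneq (src e) x.
    move=> _; have [<- _ -> //|/= _ /eqP tf ef] := eqVneq (src f) (src e).
    by move: ne nf; rewrite tf ef => /ltn_trans h /h; rewrite ltnn.
  have [sf _ ef|/= _ /eqP tf ef] := eqVneq (src f) x; last by rewrite te tf ef.
  by move: ne nf; rewrite te sf ef => /ltn_trans h /h; rewrite ltnn.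
apply: (card_near hG htrans hdim (x := val x) val_inj) => _ /imsetP[e + ->].
rewrite inE /other => /andP[h /andP[_ +]].
move: h; have [<- //|/= _ /eqP <-] := eqVneq (src e) x.
by rewrite dist_sym.
Qed.

(** The weights l e = p0 / p e equalise the contributions of all long pairs,
    since l e * p e = p0; other pairs get weight 0. *)
Lemma expected_splits :
  \sum_(e | long e) expect p (fun sg => (split_big (@src T) (@tgt T) n sg e)%:R) <=
  (volume k)%:R * (a * (volume r.*2)%:R + (a * p0 * n%:R)^-1).
Proof.
pose l e := if long e then p0 / p e else 0.
have longp e : long e -> p0 <= p e by exact: long_prob.
have lp e : l e * p e = if long e then p0 else 0.
  rewrite /l; case: ifP => [/longp h|]; last by rewrite mul0r.
  by rewrite mulfVK// gt_eqF// (lt_le_trans p0_gt0).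
have l01 e : 0 <= l e <= 1.
  rewrite /l; case: ifP => [/longp h|]; last by rewrite lexx ler01.
  have pe : 0 < p e by exact: lt_le_trans h.
  by rewrite divr_ge0 ?(ltW pe) ?(ltW p0_gt0)//= ler_pdivrMr// mul1r.
have deg x : \sum_(e | (src e == x) || (tgt e == x)) l e * p e <=
    p0 * (volume r.*2)%:R.
  under eq_bigr do rewrite lp.
  rewrite -big_mkcondr /= sumr_const -[leLHS]mulr_natr ler_pM2l// ler_nat.
  by apply: leq_trans (long_degree x); rewrite cardsE.
have := two_ghost n (pair_prob01 iota) l01 deg a_gt0.
set S := \sum_e _; set S' := \sum_(e | _) _.
have -> : S = p0 * S'.
  rewrite /S' mulr_sumr big_mkcond; apply: eq_bigr => e _; rewrite lp.
  by case: ifP => // _; rewrite mul0r.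
have -> : #|{: T}| = volume k by rewrite -cardfE.
have nR : 0 < n%:R :> R by rewrite ltr0n.
move=> h; rewrite -(ler_pM2l (mulr_gt0 nR p0_gt0)) -mulrA; apply: le_trans h _.
rewrite le_eqVlt; apply/orP; left; apply/eqP; field.
by rewrite !gt_eqF.
Qed.

Lemma merge_expect :
  (\sum_(x : T) (large_prob J beta iota x n - large_prob J beta iota x n')) *
    (volume r)%:R * m%:R <=
  (volume (k + r))%:R * m%:R * m%:R + 4 * (volume r)%:R *
    ((volume k)%:R * (a * (volume r.*2)%:R + (a * p0 * n%:R)^-1)).
Proof.
pose Cm (sg : {ffun pairs T -> bool}) :=
  [set x | n <= #|component (@src T) (@tgt T) sg x| < n']%N%SET.
have inB (t : T) : iota t \in gball o k by exact: valP.
have h1 : \sum_(x : T) (large_prob J beta iota x n - large_prob J beta iota x n') <=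
    expect p (fun sg => #|Cm sg|%:R).
  rewrite /large_prob; under eq_bigr do rewrite -mulN1r -expectZ -expectD.
  rewrite -expect_sum; apply: expect_le; first exact: pair_prob01.
  move=> sg; rewrite -sum1_card natr_sum [leRHS]big_mkcond; apply: ler_sum => x _.
  rewrite inE mulN1r ltnNge; case: (n <= _)%N; case: (n' <= _)%N => /=;
    by rewrite ?mulr1n ?mulr0n ?subrr ?subr0 ?sub0r ?lerN10 ?ler01.
have h2 : expect p (fun sg => #|Cm sg|%:R) * ((volume r)%:R * m%:R) <=
    (volume (k + r))%:R * m%:R * m%:R + 4 * (volume r)%:R *
    \sum_(e | long e) expect p (fun sg => (split_big (@src T) (@tgt T) n sg e)%:R).
  rewrite -expect_sum mulrC -!expectZ -[X in X + _](expect_cst p) -expectD.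
  apply: expect_le => [|sg]; first exact: pair_prob01.
  have := count_medium hG htrans hdim r n val_inj inB rho_small n'_small sg.
  by rewrite -(ler_nat R) natrD !natrM natr_sum -/(Cm sg) => h; rewrite mulrC mulrA.
rewrite -mulrA; apply: le_trans (ler_wpM2r _ h1) _; first by rewrite mulr_ge0.
apply: le_trans h2 _; rewrite lerD2l ler_wpM2l ?mulr_ge0//.
exact: expected_splits.
Qed.

End Merge.

Definition centre k : gball o k.
Proof.
by exists o; rewrite (in_gball hG htrans hdim) (dist_refl hG).
Defined.

Definition ball_tail k n : R := large_prob J beta (val : gball o k -> V) (centre k) n.

Lemma ball_tail_inner (s k n : nat) (x : gball o (k + s)) : (dist o (val x) <= k)%N ->
  ball_tail s n <= large_prob J beta (val : gball o (k + s) -> V) x n.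
Proof.
move=> ox; have [g ga gx] := htrans o (val x).
apply: (large_prob_embed hP hJ (g := g)) => //.
move=> t.
have gt : g (val t) \in gball o (k + s).
  rewrite (in_gball hG htrans hdim).
  apply: leq_trans (dist_triangle hG _ (val x) _) (leq_add ox _).
  by rewrite -gx (dist_automorphism hG _ _ ga) -(in_gball hG htrans hdim); exact: valP.
by exists [` gt]%fset.
Qed.

Lemma ball_tail_outer (k n : nat) (x : gball o k) :
  large_prob J beta (val : gball o k -> V) x n <= ball_tail k.*2 n.
Proof.
have [g ga gx] := htrans (val x) o.
apply: (large_prob_embed hP hJ (g := g)) => //.
move=> t.
have gt : g (val t) \in gball o k.*2.
  have -> : (g (val t) \in gball o k.*2) = (dist (val x) (val t) <= k.*2)%N.
    by rewrite (in_gball hG htrans hdim) -(dist_automorphism hG (val x) (val t) ga) gx.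
  rewrite -addnn.
  apply: leq_trans (dist_triangle hG _ o _) (leq_add _ _).
    by rewrite dist_sym// -(in_gball hG htrans hdim); exact: valP.
  by rewrite -(in_gball hG htrans hdim); exact: valP.
by exists [` gt]%fset.
Qed.

(** Inside the ball of radius k + s, a vertex at distance at most k from o sees
    a full copy of the ball of radius s around it, so that the left-hand tail is
    a lower bound for it; every vertex has its n'-tail bounded by c.  The
    boundary layer disappears as k grows, by folner. *)
Lemma merge_step (r rho m n n' : nat) (a p0 C c : R) :
  (4 * volume rho <= m)%N -> (4 * n' <= m)%N -> (0 < n)%N -> 0 < a -> 0 < p0 ->
  (forall x y, (rho < dist x y <= r.*2)%N -> p0 <= 1 - expR (- (beta * J x y))) ->
  (forall k, (0 < k)%N -> (volume k.*2)%:R <= C * (volume k)%:R) ->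
  (forall s, ball_tail s n' <= c) ->
  forall s, ball_tail s n <= c + C * m%:R / (volume r)%:R
    + 4 / m%:R * (a * (volume r.*2)%:R + (a * p0 * n%:R)^-1).
Proof.
move=> rm nm n0 a0 p00 hp hC hc s.
have vol0 k : 0 < (volume k)%:R :> R by rewrite ltr0n (volume_gt0 hG htrans hdim).
have m0 : 0 < m%:R :> R.
  by rewrite ltr0n; apply: leq_trans rm; rewrite muln_gt0 (volume_gt0 hG htrans hdim).
have C0 : 0 <= C.
  by rewrite -(pmulr_lge0 _ (vol0 1%N)); apply: le_trans (hC 1%N isT).
have c0 : 0 <= c by apply: le_trans (hc 0%N); apply: (large_prob_ge0 hP val_inj).
set A := a * _ + _.
have A0 : 0 <= A.
  have nR : 0 < n%:R :> R by rewrite ltr0n.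
  by rewrite addr_ge0 ?mulr_ge0 ?invr_ge0 ?mulr_ge0// ltW.
apply: (@folner _ _ s r.+1).
  by rewrite !addr_ge0 ?divr_ge0 ?mulr_ge0// divr_ge0// ltW.
move=> k kr; have := @merge_expect (k + s) r rho m n n' a p0 rm nm n0 a0 p00 hp.
rewrite -/A sumrB.
set S := \sum_x _; set S' := \sum_x _.
have hin : ball_tail s n * (volume k)%:R <= S.
  apply: (@le_trans _ _ (\sum_(x : gball o (k + s) | (dist o (val x) <= k)%N)
      large_prob J beta (val : gball o (k + s) -> V) x n)); last first.
    rewrite [leRHS](bigID (fun x : gball o (k + s) => (dist o (val x) <= k)%N)) /= lerDl.
    by apply: sumr_ge0 => x _; apply: (large_prob_ge0 hP val_inj).
  apply: (@le_trans _ _ (\sum_(x : gball o (k + s) | (dist o (val x) <= k)%N) ball_tail s n)).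
    rewrite sumr_const -[leRHS]mulr_natr ler_wpM2l//; first exact: (large_prob_ge0 hP val_inj).
    rewrite ler_nat -(card_gball hG htrans hdim o) cardE -(size_map val).
    apply: uniq_leq_size; first exact: fset_uniq.
    move=> y; rewrite (in_gball hG htrans hdim) => oy.
    have yk : y \in gball o (k + s).
      by rewrite (in_gball hG htrans hdim) (leq_trans oy)// leq_addr.
    by apply/mapP; exists [` yk]%fset; rewrite // mem_enum.
  by apply: ler_sum => x; exact: ball_tail_inner.
have hout : S' <= c * (volume (k + s))%:R.
  apply: (@le_trans _ _ (\sum_(x : gball o (k + s)) c)).
    by apply: ler_sum => x _; apply: le_trans (ball_tail_outer _ _) (hc _).
  by rewrite sumr_const -[leLHS]mulr_natr -cardfE.
have hvol : (volume (k + s + r))%:R <= C * (volume (k + s))%:R.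
  apply: le_trans (hC (k + s)%N _); last by lia.
  by rewrite ler_nat; apply: (volume_mono hG htrans hdim); lia.
set v := (volume r)%:R; set N := (volume (k + s))%:R.
have v0 : 0 < v := vol0 r.
move=> h; apply: (le_trans hin).
have h2 : (S - S') * v * m%:R <= C * N * m%:R * m%:R + 4 * v * (N * A).
  by apply: le_trans h _; rewrite lerD2r !ler_wpM2r// ltW.
have h3 : S - S' <= (C * m%:R / v + 4 / m%:R * A) * N.
  rewrite -(ler_pM2r v0) -(ler_pM2r m0); apply: le_trans h2 _.
  rewrite le_eqVlt; apply/orP; left; apply/eqP; field.
  by rewrite !gt_eqF.
have -> : (c + C * m%:R / v + 4 / m%:R * A) * N =
  c * N + (C * m%:R / v + 4 / m%:R * A) * N by ring.
by rewrite -/N in hout; lra.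
Qed.

End Step.

(** * The percolation probability as a limit over balls *)

Section Theta.
Variables (R : realType) (V : choiceType) (E : rel V) (o : V) (d : nat).
Hypothesis hG : infinite_graph E.
Hypothesis htrans : transitive_graph E.
Hypothesis hdim : growth_dimension E R o d.
Notation dist := (graph_dist E).
Notation gball := (gball E o).
Notation centre := (centre hG htrans hdim).

Definition ball_tail_event (n k : nat) : set (config_space V) :=
  large_event (val_inj : injective (val : gball k -> V)) (centre k) n.

Definition tail_event (n : nat) : set (config_space V) :=
  \bigcup_k ball_tail_event n k.

Lemma ball_tail_event_mono n : {homo ball_tail_event n : k k' / (k <= k')%N >-> k `<=` k'}.
Proof.
move=> k k' kk; apply: large_event_embed => // t.
have tk : val t \in gball k'.
  rewrite (in_gball hG htrans hdim) (leq_trans _ kk)//.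
  by rewrite -(in_gball hG htrans hdim); exact: valP.
by exists [` tk]%fset.
Qed.

Lemma measurable_tail_event n : measurable (tail_event n).
Proof. by apply: bigcupT_measurable => k; exact: measurable_large_event. Qed.

Lemma tail_event_anti n n' : (n <= n')%N ->
  tail_event n' `<=` tail_event n.
Proof. by move=> nn w [k _ h]; exists k => //; exact: leq_trans h. Qed.

Lemma path_in_ball (w : config V) (x : V) (p : seq V) (k : nat) :
  path (joined w) x p -> all [in gball k] (x :: p) ->
  forall x' : gball k, val x' = x -> exists2 y' : gball k, val y' = last x p &
    y' \in component (@src _) (@tgt _) (local_config val_inj w) x'.
Proof.
elim: p x => [|z p IH] x /=.
  by move=> _ _ x' xx; exists x' => //; exact: component_refl.
move=> /andP[xz zp] /and3P[xk zk pk] x' xx.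
have [|y' yy cy] := IH z zp _ [` zk]%fset erefl; first by rewrite /= zk.
exists y' => //; move: cy; rewrite !inE; apply: connect_trans; apply: connect1.
by rewrite adj_local_config /= xx.
Qed.

Lemma cluster_in_ball (w : config V) (B : seq V) : {in B, forall y, Defs.cluster w o y} ->
  exists k, {in B, forall y, exists2 y' : gball k, val y' = y &
    y' \in component (@src _) (@tgt _) (local_config val_inj w) (centre k)}.
Proof.
move=> BK.
suff [k hk] : exists k, {in B, forall y, exists2 p, path (joined w) o p &
    last o p = y /\ all [in gball k] (o :: p)}.
  exists k => y /hk[p pp [lp pk]].
  by have [y' yy cy] := path_in_ball pp pk (erefl : val (centre k) = o);
    exists y'; rewrite ?yy.
elim: B BK => [|y B IH] BK; first by exists 0%N.
have [|k hk] := IH; first by move=> z zB; apply: BK; rewrite inE zB orbT.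
have [p pp lp] := BK y (mem_head _ _).
pose k' := (\sum_(z <- o :: p) dist o z + k)%N.
have big_ball z j j' : (j <= j')%N -> z \in gball j -> z \in gball j'.
  by rewrite !(in_gball hG htrans hdim) => jj /leq_trans; exact.
exists k' => z; rewrite inE => /orP[/eqP ->|zB].
  exists p => //; split=> //; apply/allP => u up.
  rewrite (in_gball hG htrans hdim) /k' (big_rem u up) /=; lia.
have [q qp [lq qk]] := hk z zB; exists q => //; split => //.
apply: sub_all qk => u; apply: big_ball; exact: leq_addl.
Qed.

(** Finitely many vertices of the cluster, with paths leading to them, fit in a
    common ball. *)
Lemma infinite_cluster_eq : [set w : config_space V | infinite_set (Defs.cluster w o)] =
  \bigcap_n tail_event n.
Proof.
apply/seteqP; split => w /=.
  move=> inf n _; have [B BK nB] := infinite_set_fset n inf.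
  have [|k hk] := @cluster_in_ball w B; first by move=> y yB; exact: BK.
  exists k => //; apply: leq_trans nB _.
  rewrite cardE -(size_map val); apply: uniq_leq_size; first exact: fset_uniq.
  by move=> y /hk[y' <- cy]; apply: map_f; rewrite mem_enum.
move=> h; apply/infinite_set_fsetP => n; have [k _ hk] := h n I.
exists [fset val y' | y' in component (@src _) (@tgt _) (local_config val_inj w) (centre k)]%fset.
  move=> _ /= /imfsetP[y' /= + ->]; rewrite inE => /connectP[p pp ->].
  exists [seq val z | z <- p]; last exact: (last_map val p (centre k)).
  suff : path (joined w) (val (centre k)) [seq val z | z <- p] by [].
  rewrite path_map; move: pp; congr is_true; apply: eq_path => u v.
  by rewrite /= adj_local_config.
rewrite card_imfset/=; last exact: val_inj.
move: hk; rewrite /ball_tail_event /large_event /= => /leq_trans; apply.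
by rewrite cardE.
Qed.

Variables (J : V -> V -> R) (beta : R) (P : R -> probability (config_space V) R).
Hypothesis hP : percolation_law J beta (P beta).
Notation ball_tail := (ball_tail hG htrans hdim J beta).

Lemma tail_event_le n c : (forall k, ball_tail k n <= c) ->
  (P beta (tail_event n) <= c%:E)%E.
Proof.
move=> h.
have cv := @nondecreasing_cvg_mu _ _ _ (P beta) (ball_tail_event n)
  (fun k => measurable_large_event _ _ _) (measurable_tail_event n) _.
have {}cv : P beta (ball_tail_event n k) @[k --> \oo] --> P beta (tail_event n).
  by apply: cv => k k' kk; apply/subsetPset; exact: ball_tail_event_mono.
rewrite -(cvg_lim _ cv)//; apply: lime_le; first exact: cvgP cv.
by apply: nearW => k; rewrite (large_eventE hP) lee_fin; exact: h.
Qed.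

Lemma ball_tail_le k n : ((ball_tail k n)%:E <= P beta (tail_event n))%E.
Proof.
rewrite -(large_eventE hP val_inj); apply: le_measure; rewrite ?inE.
- exact: measurable_large_event.
- exact: measurable_tail_event.
- by move=> w wk; exists k.
Qed.

Lemma theta_ge0 : 0 <= theta P o beta.
Proof. exact: fine_ge0. Qed.

Lemma measurable_infinite :
  measurable [set w : config_space V | infinite_set (Defs.cluster w o)].
Proof.
rewrite infinite_cluster_eq; apply: bigcapT_measurable => n.
exact: measurable_tail_event.
Qed.

Lemma thetaE : P beta [set w | infinite_set (Defs.cluster w o)] = (theta P o beta)%:E.
Proof. by rewrite fineK// fin_num_measure//; exact: measurable_infinite. Qed.

Lemma theta_ge c : (forall n, exists2 n', (n <= n')%N & exists k, c < ball_tail k n') ->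
  c <= theta P o beta.
Proof.
move=> h; rewrite -lee_fin -thetaE infinite_cluster_eq.
have cv := @nonincreasing_cvg_mu _ _ _ (P beta) tail_event _
  measurable_tail_event _ _.
have {}cv : P beta (tail_event n) @[n --> \oo] -->
    P beta (\bigcap_n tail_event n).
  apply: cv => [||n n' nn].
  - by rewrite -ge0_fin_numE// fin_num_measure//; exact: measurable_tail_event.
  - by rewrite -infinite_cluster_eq; exact: measurable_infinite.
  - by apply/subsetPset; exact: tail_event_anti.
rewrite -(cvg_lim _ cv)//; apply: lime_ge; first exact: cvgP cv.
apply: nearW => n; have [n' nn [k hk]] := h n.
apply: (@le_trans _ _ (P beta (tail_event n'))).
  by apply: le_trans (ball_tail_le k n'); rewrite lee_fin ltW.
by apply: le_measure; rewrite ?inE; [exact: measurable_tail_event|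
  exact: measurable_tail_event|exact: tail_event_anti].
Qed.

Lemma theta_lt_ball_tail c n : c < theta P o beta -> exists k, c < ball_tail k n.
Proof.
move=> ct; apply: contrapT => no.
have : (P beta (tail_event n) <= c%:E)%E.
  apply: tail_event_le => k; rewrite leNgt; apply/negP => ck.
  by apply: no; exists k.
move: ct; rewrite -lte_fin -thetaE => /lt_le_trans h; apply/negP; rewrite -ltNge.
apply: h; apply: le_measure; rewrite ?inE.
- exact: measurable_infinite.
- exact: measurable_tail_event.
- by rewrite infinite_cluster_eq; exact: bigcap_inf.
Qed.

End Theta.

(** * Choice of the scales *)

Section Scales.
Variable R : realType.

Lemma expr_eventually (q C : R) : 1 < q -> exists j, forall i, (j <= i)%N -> C <= q ^+ i.
Proof.
move=> q1; have [j hj] := @expr_unbounded R q C q1; exists j => i ji.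
by apply: (le_trans (ltW hj)); rewrite ler_weXn2l// ltW.
Qed.

(** The sizes are N i of order (z X)^i, where X^i is the volume at scale i and
    z^i the relative error.  The last condition reads (z^5 v X^2)^i >= const,
    and holds for z close to 1 since v X^2 > 1. *)
Lemma scales (X v M : R) : 1 < X -> 0 < v -> v * X < 1 -> 1 < v * X ^+ 2 ->
  exists (z : R) (m N : nat -> nat) (i1 : nat), [/\ 0 < z < 1,
    forall n, exists j, forall i, (j <= i)%N -> (n <= N i)%N &
    forall i, (i1 <= i)%N ->
      [/\ (4 * N i.+1 <= m i)%N, M <= (m i)%:R, (0 < N i)%N,
          (m i)%:R <= (z * X) ^+ i <= 2 * (m i)%:R &
          1 <= (N i)%:R * (z ^+ 4 * v * X) ^+ i]].
Proof.
move=> X1 v0 vX vXX; pose w := v * X ^+ 2.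
have w1 : 1 < w by [].
(* The constant 10 makes (1 - 5 e) w = (w + 1) / 2, midway between 1 and w. *)
pose e := (1 - w^-1) / 10.
have wi : 0 < w^-1 < 1 by rewrite invr_gt0 invf_lt1 ?w1 ?andbT; lra.
pose z := 1 - e.
have e01 : 0 < e < 10^-1 by rewrite /e; lra.
have z01 : 0 < z < 1 by rewrite /z; lra.
have z5 : 1 - 5 * e <= z ^+ 5.
  have -> : z ^+ 5 = 1 - 5 * e + e ^+ 2 * (10 - 10 * e + 5 * e ^+ 2 - e ^+ 3).
    by rewrite /z; ring.
  rewrite lerDl mulr_ge0 ?sqr_ge0//.
  have e3 : e ^+ 3 <= 1 by rewrite exprn_ile1//; lra.
  have := sqr_ge0 e; lra.
pose q := z ^+ 5 * w.
have q1 : 1 < q.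
  have h : (1 - 5 * e) * w <= q by rewrite ler_wpM2r//; lra.
  suff : (1 - 5 * e) * w = (w + 1) / 2 by lra.
  by rewrite /e; field; rewrite gt_eqF//; lra.
pose y := z * X.
have y1 : 1 < y.
  have z0 : 0 < z by case/andP: z01.
  have h5 : z ^+ 5 <= z by rewrite -[leRHS]expr1 ler_wiXn2l//; lra.
  have X0 : 0 < X by lra.
  have -> : y = z * X by [].
  apply: lt_le_trans q1 _; rewrite /q /w.
  have -> : z ^+ 5 * (v * X ^+ 2) = (z ^+ 5 * X) * (v * X) by ring.
  apply: (@le_trans _ _ (z ^+ 5 * X)); last by rewrite ler_wpM2r// ltW.
  by rewrite ler_piMr ?(ltW vX)// mulr_ge0 ?exprn_ge0// ltW.
have yi1 i : 1 <= y ^+ i by rewrite exprn_ege1// ltW.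
pose m i := Num.trunc (y ^+ i).
have mi i : (m i)%:R <= y ^+ i < (m i).+1%:R.
  by apply: truncn_itv; apply: le_trans (yi1 i).
pose N i := (m i.-1 %/ 4)%N.
have Nlow i : (0 < i)%N -> y ^+ i <= y * (4 * (N i)%:R + 4).
  case: i => // i _; rewrite exprS ler_pM2l; last by lra.
  have /andP[_ h] := mi i; apply: (le_trans (ltW h)).
  have : (m i < (N i.+1).+1 * 4)%N by rewrite /N /= ltn_ceil.
  rewrite -(ler_nat R) => h2; apply: le_trans h2 _.
  by rewrite natrM -natr1; lra.
(* Past these thresholds the roundings in m and N cost at most a factor 2. *)
have [j1 hj1] := expr_eventually (8 * y + `|M| + 1) y1.
have [j2 hj2] := expr_eventually (8 * y) q1.
have Nlow2 i : (maxn 1 j1 <= i)%N -> y ^+ i <= 8 * y * (N i)%:R.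
  rewrite geq_max => /andP[i0 /hj1 h1]; have := Nlow i i0.
  have := normr_ge0 M; lra.
have Ngt0 i : (maxn 1 j1 <= i)%N -> (0 < N i)%N.
  move=> /Nlow2 h; rewrite lt0n; apply/eqP => N0; move: h.
  by rewrite N0 mulr0; have := yi1 i; lra.
exists z, m, N, (maxn (maxn 1 j1) j2); split => //.
  move=> n; have [j3 hj3] := expr_eventually (8 * y * n%:R) y1.
  exists (maxn (maxn 1 j1) j3) => i; rewrite geq_max => /andP[/Nlow2 h1 /hj3 h3].
  rewrite -(ler_nat R); have y8 : 0 < 8 * y by lra.
  by rewrite -(ler_pM2l y8) (le_trans h3).
move=> i; rewrite geq_max => /andP[i1 i2].
have /andP[mlo mhi] := mi i; rewrite -natr1 in mhi.
split.
- by rewrite /N /= mulnC leq_trunc_div.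
- have := hj1 i (leq_trans (leq_maxr _ _) i1); have := ler_norm M; lra.
- exact: Ngt0.
- have m1 : 1 <= (m i)%:R :> R.
    rewrite ler1n lt0n; apply/eqP => m0; move: mhi; rewrite m0.
    by have := yi1 i; lra.
  by rewrite mlo /=; lra.
- have qi : y ^+ i * (z ^+ 4 * v * X) ^+ i = q ^+ i.
    by rewrite -exprMn; congr (_ ^+ _); rewrite /y /q /w; ring.
  have h1 := Nlow2 i i1; have h2 := hj2 i i2.
  have p0 : 0 <= (z ^+ 4 * v * X) ^+ i.
    by rewrite exprn_ge0// !mulr_ge0 ?exprn_ge0//; lra.
  have y8 : 0 < 8 * y by lra.
  rewrite -(ler_pM2l y8) mulr1 (le_trans h2)// -qi mulrA.
  by rewrite ler_wpM2r.
Qed.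

(** With c^i the volume at scale i, v^i the order of the probability p0 of a
    long pair and (z^2)^i the free parameter of two_ghost, each of the three
    contributions to the error of merge_step is of order z^i. *)
Lemma error_bound (v z c C cG CG c3 m N volr vol2r p0 : R) (i : nat) :
  [/\ 0 < v, 0 < z, 0 < c, 0 < C & 0 < cG] -> 0 < CG -> 0 < c3 -> 0 < N ->
  cG * c ^+ i <= volr -> vol2r <= CG * c * c ^+ i -> c3 * v ^+ i <= p0 ->
  m <= (z * c) ^+ i <= 2 * m -> 1 <= N * (z ^+ 4 * v * c) ^+ i ->
  C * m / volr + 4 / m * ((z ^+ 2) ^+ i * vol2r + ((z ^+ 2) ^+ i * p0 * N)^-1) <=
  (C / cG + 8 * (CG * c + c3^-1)) * z ^+ i.
Proof.
move=> [v0 z0 c0 C0 cG0] CG0 c30 N0 hvr hv2 hp.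
set Z := z ^+ i; set Y := c ^+ i; set W := v ^+ i in hp *.
have -> : (z * c) ^+ i = Z * Y by exact: exprMn.
have -> : (z ^+ 4 * v * c) ^+ i = Z ^+ 4 * W * Y.
  by rewrite (exprMn i (z ^+ 4 * v) c) (exprMn i (z ^+ 4) v) -!exprM mulnC.
have -> : (z ^+ 2) ^+ i = Z ^+ 2 by rewrite -!exprM mulnC.
have Z0 : 0 < Z by rewrite exprn_gt0.
have Y0 : 0 < Y by rewrite exprn_gt0.
have W0 : 0 < W by rewrite exprn_gt0.
move=> /andP[m1 m2] hN.
have m0 : 0 < m by have := mulr_gt0 Z0 Y0; lra.
have volr0 : 0 < volr by apply: lt_le_trans hvr; rewrite mulr_gt0.
have p00 : 0 < p0 by apply: lt_le_trans hp; rewrite mulr_gt0.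
have t1 : C * m / volr <= C / cG * Z.
  rewrite ler_pdivrMr//; apply: (@le_trans _ _ (C / cG * Z * (cG * Y))).
    have -> : C / cG * Z * (cG * Y) = C * (Z * Y) by field; rewrite gt_eqF.
    by rewrite ler_wpM2l// ltW.
  by rewrite ler_wpM2l// !mulr_ge0// ?invr_ge0 ltW.
have t2 : 4 / m <= 8 / (Z * Y).
  by rewrite ler_pdivrMr// mulrAC ler_pdivlMr ?mulr_gt0//; lra.
have t3 : (Z ^+ 2 * p0 * N)^-1 <= Z ^+ 2 * Y / c3.
  rewrite -[leLHS]mul1r ler_pdivrMr ?mulr_gt0 ?exprn_gt0//.
  apply: (le_trans hN).
  have -> : Z ^+ 2 * Y / c3 * (Z ^+ 2 * p0 * N) = N * (Z ^+ 4 * (p0 / c3) * Y) by ring.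
  rewrite ler_pM2l// ler_pM2r// ler_pM2l ?exprn_gt0// ler_pdivlMr// mulrC.
  exact: hp.
have t4 : 4 / m * (Z ^+ 2 * vol2r + (Z ^+ 2 * p0 * N)^-1) <=
    8 / (Z * Y) * (Z ^+ 2 * (CG * c * Y) + Z ^+ 2 * Y / c3).
  have v2 : Z ^+ 2 * vol2r <= Z ^+ 2 * (CG * c * Y) by rewrite ler_pM2l ?exprn_gt0.
  have [v2p|v2n] := leP 0 (Z ^+ 2 * vol2r + (Z ^+ 2 * p0 * N)^-1).
    apply: ler_pM => //; first by rewrite divr_ge0// ltW.
    exact: lerD.
  apply: (@le_trans _ _ 0).
    by rewrite mulr_ge0_le0// ?(ltW v2n)// divr_ge0// ltW.
  by rewrite ltW// !(mulr_gt0, addr_gt0, invr_gt0, exprn_gt0).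
have -> : (C / cG + 8 * (CG * c + c3^-1)) * Z =
    C / cG * Z + 8 / (Z * Y) * (Z ^+ 2 * (CG * c * Y) + Z ^+ 2 * Y / c3).
  by field; rewrite !gt_eqF.
exact: lerD.
Qed.

Lemma two_powR_gt1 (t : R) : 0 < t -> 1 < 2 `^ t.
Proof.
move=> t0; have := @gt0_ltr_powR R t t0 1 2.
by rewrite powR1 !qualifE /= ler01 ler0n ltr1n; apply.
Qed.

(** From exp(- u) <= 1 / (1 + u). *)
Lemma exp_lower (u u0 : R) : 0 <= u <= u0 -> u / (1 + u0) <= 1 - expR (- u).
Proof.
move=> /andP[u1 u2]; have h := expR_ge1Dx u.
have e1 : expR (- u) <= (1 + u)^-1.
  by rewrite expRN lef_pV2 ?posrE ?expR_gt0//; lra.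
have e2 : u * (1 + u0)^-1 <= u * (1 + u)^-1.
  by rewrite ler_wpM2l// lef_pV2 ?posrE; lra.
have e3 : u * (1 + u)^-1 = 1 - (1 + u)^-1 by field; rewrite gt_eqF//; lra.
lra.
Qed.

End Scales.

(** * Continuity in the parameter *)

Section Continuity.
Variables (R : realType) (V : choiceType) (J : V -> V -> R).

(** A polynomial in finitely many edge probabilities. *)
Lemma large_prob_continuous (T : finType) (iota : T -> V) x n :
  continuous (fun b : R => large_prob J b iota x n).
Proof.
move=> b; rewrite /continuous_at /large_prob /expect /weight.
have addc : continuous (fun z : R * R => z.1 + z.2) by exact: add_continuous.
have mulc : continuous (fun z : R * R => z.1 * z.2) by exact: mul_continuous.
apply: (@cvg_big R _ +%R 0 (fun=> true) addc _ (nbhs b)) => sg _.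
apply: cvgM; last exact: cvg_cst.
apply: (@cvg_big R _ *%R 1 (fun=> true) mulc _ (nbhs b)) => e _.
have ce : continuous (fun c : R => expR (- (c * J (iota (src e)) (iota (tgt e))))).
  move=> c; apply: continuous_comp; last exact: continuous_expR.
  by apply: cvgN; apply: cvgM; [exact: cvg_id|exact: cvg_cst].
rewrite /bern /pair_prob; case: (sg e).
  by apply: cvgB; [exact: cvg_cst|exact: ce].
by apply: cvgB; [exact: cvg_cst|apply: cvgB; [exact: cvg_cst|exact: ce]].
Qed.

End Continuity.

(** * The finite-volume criterion and openness *)

Section Criterion.
Variables (R : realType) (V : choiceType) (E : rel V) (o : V) (d : nat).
Variables (J : V -> V -> R) (alpha : R).
Hypothesis hG : infinite_graph E.
Hypothesis htrans : transitive_graph E.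
Hypothesis hd : (1 <= d)%N.
Hypothesis hdim : growth_dimension E R o d.
Hypothesis hJ : transitive_kernel E J.
Hypothesis halpha : 1 < alpha < 2.
Hypothesis hOmega : kernel_Omega E J (- (d%:R * alpha)).
Notation dist := (graph_dist E).
Notation volume := (volume E o).
Notation X := (2 ^+ d : R).

(** By how much the lower bound on the kernel shrinks when distances double. *)
Definition decay : R := 2 `^ (- (d%:R * alpha)).

Lemma decay_gt0 : 0 < decay. Proof. exact: powR_gt0. Qed.

(** The two products are 2^(d (1 - alpha)) and 2^(d (2 - alpha)). *)
Lemma decay_volume : decay * X < 1 /\ 1 < decay * X ^+ 2.
Proof.
have d0 : 0 < d%:R :> R by rewrite ltr0n.
have XE : X = 2 `^ d%:R by rewrite powR_mulrn.
have nz : (2 : R) != 0 by [].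
rewrite /decay XE expr2 -!powRD ?nz ?implybT//.
case/andP: halpha => a1 a2; split; last by apply: two_powR_gt1; nra.
have -> : - (d%:R * alpha) + d%:R = - (d%:R * (alpha - 1)) by ring.
rewrite powRN invf_lt1 ?powR_gt0//; apply: two_powR_gt1.
by rewrite mulr_gt0// subr_gt0.
Qed.

(** On pairs at distance at most 2^(i + 1) the power law is smallest at that
    distance, where it equals decay^(i + 1). *)
Lemma kernel_lower : exists (cJ : R) (rho : nat), 0 < cJ /\
  forall i x y, (rho < dist x y <= (2 ^ i).*2)%N -> cJ * decay ^+ i.+1 <= J x y.
Proof.
have [cJ [RJ [cJ0 RJ0 h]]] := hOmega; exists cJ, (Num.bound RJ); split => //.
move=> i x y /andP[xy1 xy2]; apply: le_trans (h x y _); last first.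
  by rewrite ltW// (lt_le_trans (archi_boundP (ltW RJ0)))// ler_nat ltnW.
have d0 : 0 < (dist x y)%:R :> R by rewrite ltr0n (leq_ltn_trans _ xy1).
have s0 : 0 <= d%:R * alpha by case/andP: halpha => a1 _; rewrite mulr_ge0//; lra.
rewrite ler_pM2l// /decay -powR_mulrn ?powR_ge0// -powRrM mulrC powRrM.
rewrite powR_mulrn// !powRN lef_pV2 ?posrE ?powR_gt0//.
apply: ge0_ler_powR; rewrite ?nnegrE ?exprn_ge0//.
by rewrite -natrX ler_nat expnS mul2n.
Qed.

(** If all tails at size N (i + j) were at most c, then j applications of
    merge_step would bound the tails at size N i by c plus a geometric sum of
    errors.  So the hypothesis forces tails above c at arbitrarily large sizes.
    The constants depend on beta only through its lower bound beta0. *)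
Lemma finite_criterion (beta0 : R) : 0 < beta0 ->
  exists (K z : R) (N : nat -> nat) (i1 : nat), [/\ 0 < K, 0 < z < 1 &
    forall beta (P : R -> probability (config_space V) R), beta0 <= beta ->
    percolation_law J beta (P beta) -> forall i c, (i1 <= i)%N ->
    (exists k, c + K * z ^+ i < ball_tail hG htrans hdim J beta k (N i)) ->
    c <= theta P o beta].
Proof.
move=> b0; have [cJ [rho [cJ0 hlow]]] := kernel_lower.
have [cG [CG [cG0 CG0 hvol]]] := hdim.
have [C C0 hC] := volume_doubling hdim.
have [vX vXX] := decay_volume.
have X1 : 1 < X by rewrite exprn_egt1// ?ltr1n//; lia.
have [z [m [N [i1 [z01 Nunb hsc]]]]] :=
  scales (4 * volume rho)%:R X1 decay_gt0 vX vXX.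
have [z0 z1] := andP z01.
pose u0 := beta0 * cJ; have u00 : 0 < u0 by rewrite mulr_gt0.
pose c3 := u0 * decay / (1 + u0).
have c30 : 0 < c3 by rewrite divr_gt0 ?mulr_gt0 ?decay_gt0//; lra.
have d01 : decay <= 1.
  rewrite -[leRHS]mul1r -(ler_pM2r (_ : 0 < X)); last by lra.
  by rewrite mul1r; lra.
pose K0 := C / cG + 8 * (CG * X + c3^-1).
have K00 : 0 < K0.
  by rewrite /K0 addr_gt0 ?divr_gt0// mulr_gt0// addr_gt0 ?invr_gt0// mulr_gt0//; lra.
(* Sum of the geometric series of errors. *)
pose K := K0 / (1 - z); have K0z : 0 < K by rewrite divr_gt0//; lra.
exists K, z, N, i1; split => // beta P bb hP i c ii.
have bp : 0 <= beta by lra.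
have step j c' : (i1 <= j)%N ->
    (forall s, ball_tail hG htrans hdim J beta s (N j.+1) <= c') ->
    forall s, ball_tail hG htrans hdim J beta s (N j) <= c' + K0 * z ^+ j.
  move=> /hsc[h1 h2 h3 h4 h5] hc s.
  pose p0 := 1 - expR (- (u0 * decay ^+ j.+1)).
  have w0 : 0 <= u0 * decay ^+ j.+1 <= u0.
    have di : 0 <= decay ^+ j.+1 by rewrite exprn_ge0// ltW// decay_gt0.
    have di1 : decay ^+ j.+1 <= 1 by rewrite exprn_ile1// ltW// decay_gt0.
    by apply/andP; split; [rewrite mulr_ge0// ltW|rewrite ler_piMr// ltW].
  have p0low : c3 * decay ^+ j <= p0.
    apply: le_trans (exp_lower w0); rewrite /c3 exprS le_eqVlt.
    by apply/orP; left; apply/eqP; field; rewrite gt_eqF//; lra.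
  have p00 : 0 < p0.
    by apply: lt_le_trans p0low; rewrite mulr_gt0 ?exprn_gt0 ?decay_gt0.
  have long x y : (rho < dist x y <= (2 ^ j).*2)%N ->
      p0 <= 1 - expR (- (beta * J x y)).
    move=> /hlow h; rewrite lerD2l lerN2 ler_expR lerN2.
    apply: (@le_trans _ _ (beta0 * J x y)).
      by rewrite /u0 -mulrA ler_pM2l.
    by rewrite ler_wpM2r// (kernel_ge0 hJ).
  have a0 : 0 < (z ^+ 2) ^+ j by rewrite !exprn_gt0.
  rewrite ler_nat in h2.
  have := merge_step hJ bp hP h2 h1 h3 a0 p00 long hC hc s.
  move=> /le_trans; apply; rewrite -addrA lerD2l.
  have r0 : (0 < 2 ^ j)%N by rewrite expn_gt0.
  apply: (@error_bound R decay) => //.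
  - by split => //; exact: decay_gt0.
  - by rewrite ltr0n.
  - have /andP[h _] := hvol _ r0; apply: le_trans h.
    by rewrite natrX -!exprM mulnC.
  - have /andP[_ h] := hvol (2 ^ j).*2%N (etrans (double_gt0 _) r0); apply: le_trans h _.
    by rewrite -mul2n natrM natrX exprMn -!exprM mulnC mulrA.
have chain j c' : (forall s, ball_tail hG htrans hdim J beta s (N (i + j)%N) <= c') ->
    forall s, ball_tail hG htrans hdim J beta s (N i) <=
      c' + K * (z ^+ i - z ^+ (i + j)%N).
  elim: j c' => [|j IH] c' hc s; first by move: (hc s); rewrite addn0 subrr mulr0 addr0.
  rewrite addnS in hc *.
  have := IH _ (step (i + j)%N c' (leq_trans ii (leq_addr _ _)) hc) s.
  move=> /le_trans; apply; rewrite le_eqVlt; apply/orP; left; apply/eqP.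
  by rewrite exprS /K; field; rewrite gt_eqF//; lra.
move=> [k hk]; apply: (theta_ge (hG := hG) (htrans := htrans) (hdim := hdim) (P := P) hP) => n.
have [j hj] := Nunb n; exists (N (i + j)%N); first by apply: hj; rewrite leq_addl.
apply: contrapT => no.
have h s : ball_tail hG htrans hdim J beta s (N (i + j)%N) <= c.
  by rewrite leNgt; apply/negP => cs; apply: no; exists s.
have := chain j c h k; apply/negP; rewrite -ltNge; apply: le_lt_trans hk.
rewrite lerD2l ler_pM2l// gerBl exprn_ge0//; exact: ltW.
Qed.

End Criterion.

(** At parameter 0 all edges are closed almost surely. *)
Lemma theta0 (R : realType) (V : choiceType) (E : rel V) (o : V) (d : nat)
    (J : V -> V -> R) (P : R -> probability (config_space V) R) :
  infinite_graph E -> transitive_graph E -> growth_dimension E R o d ->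
  percolation_law J 0 (P 0) -> theta P o 0 = 0.
Proof.
move=> hG htrans hdim hP; apply/eqP; rewrite eq_le (theta_ge0 o 0 P) andbT leNgt.
apply/negP => /(theta_lt_ball_tail hG htrans hdim (P := P) hP 2)[k].
apply/negP; rewrite -leNgt le_eqVlt; apply/orP; left; apply/eqP.
rewrite /ball_tail /large_prob /expect big1// => sg _.
have [[e se]|none] := pselect (exists e, sg e).
  by rewrite /weight (bigD1 e)//= se /bern /pair_prob mul0r oppr0 expR0 subrr !mul0r.
have -> : component (@src _) (@tgt _) sg (centre hG htrans hdim k) =
    [set centre hG htrans hdim k]%SET.
  apply/setP => y; rewrite !inE; apply/connectP/eqP => [[[|z p] /=]|->].
  - by move=> _ ->.
  - by move=> /andP[/existsP[e /andP[se _]]] _ _; case: none; exists e.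
  - by exists [::].
by rewrite cards1 mulr0.
Qed.

Theorem theorem1p3 (R : realType) (V : choiceType) (E : rel V) (o : V)
    (d : nat) (J : V -> V -> R) (alpha : R)
    (P : R -> probability (config_space V) R)
    (hG : infinite_graph E) (htrans : transitive_graph E)
    (hd : (1 <= d)%N) (hdim : growth_dimension E R o d)
    (hJ : transitive_kernel E J)
    (halpha : 1 < alpha < 2)
    (hOmega : kernel_Omega E J (- (d%:R * alpha)))
    (hP : forall beta : R, 0 <= beta -> percolation_law J beta (P beta)) :
  open (percolating P o : set (subspace `[0, +oo[)) /\
  theta P o (beta_c P o) = 0.
Proof.
have t0 : theta P o 0 = 0 by apply: theta0 hG htrans hdim _; exact: hP.
have opn : open (percolating P o).
  rewrite openE => b /= [b0 tb].
  have bpos : 0 < b.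
    by rewrite lt_neqAle b0 andbT; apply/eqP => b00; move: tb; rewrite -b00 t0 ltxx.
  (* A lower bound on nearby parameters, for which the criterion is uniform. *)
  have b2 : 0 < b / 2 by lra.
  have [K [z [N [i1 [K0 /andP[z0 z1] crit]]]]] :=
    finite_criterion hG htrans hd hdim hJ halpha hOmega b2.
  set t := theta P o b in tb.
  have [i ii Kz] : exists2 i, (i1 <= i)%N & K * z ^+ i <= t / 4.
    have zi1 : 1 < z^-1 by rewrite invf_gt1.
    have [j hj] := expr_eventually (4 * K / t) zi1.
    exists (maxn i1 j); first exact: leq_maxl.
    have := hj _ (leq_maxr i1 j); rewrite exprVn.
    have zp : 0 < z ^+ maxn i1 j by rewrite exprn_gt0.
    rewrite ler_pdivrMr// -[leRHS]mulrC ler_pdivlMr//; lra.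
  have [k hk] : exists k, t / 2 < ball_tail hG htrans hdim J b k (N i).
    by apply: (theta_lt_ball_tail hG htrans hdim (P := P) (hP _ b0)); rewrite -/t; lra.
  have near1 : \forall b' \near b, t / 2 < ball_tail hG htrans hdim J b' k (N i).
    have cont : ball_tail hG htrans hdim J b' k (N i) @[b' --> b] -->
        ball_tail hG htrans hdim J b k (N i) by exact: large_prob_continuous.
    exact: cvgr_gt cont _ hk.
  have near2 : \forall b' \near b, b / 2 < b' by apply: lt_nbhsr; lra.
  near=> b'.
  have h2 : b / 2 < b' by near: b'.
  have b'0 : 0 <= b' by lra.
  split => //; apply: (@lt_le_trans _ _ (t / 4)); first lra.
  apply: (crit b' P (ltW h2) (hP _ b'0) i _ ii); exists k.
  have h1 : t / 2 < ball_tail hG htrans hdim J b' k (N i) by near: b'.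
  lra.
split; first exact: open_subspaceW.
have cge0 : 0 <= beta_c P o.
  have [p0|/set0P[b hb]] := eqVneq (percolating P o) set0; first by rewrite /beta_c p0 inf0.
  by apply: lb_le_inf; [exists b|move=> x []].
apply/eqP; rewrite eq_le theta_ge0 andbT leNgt; apply/negP => tc.
have cpos : 0 < beta_c P o.
  by rewrite lt_neqAle cge0 andbT; apply/eqP => b00; move: tc; rewrite -b00 t0 ltxx.
have : \forall b \near beta_c P o, percolating P o b.
  by apply: open_nbhs_nbhs; split.
move=> /nbhs_ballP[e /= e0 he].
have /he[b0 tb] : ball (beta_c P o) e (beta_c P o - e / 2).
  by rewrite /ball /= opprB addrC subrK gtr0_norm; lra.
have : beta_c P o <= beta_c P o - e / 2.
  by apply: ge_inf; [exists 0 => x []|split].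
lra.
Unshelve. all: by end_near.
Qed.
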